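(* Let $1\le k\le d$, let $\mathtt C$ be the class of $k$-CNFs in $d$ variables and $\mathtt C^+$ the class of monotone $k$-CNFs in $d$ variables. Then $$\binom dk\le\dim_{\mathrm{VC}}\mathtt C^+\le\dim_h\mathtt C^+\le\sum_{i=0}^k\binom di\le(ed/k)^k,$$ $$\binom dk\le\dim_{\mathrm{VC}}\mathtt C\le\dim_h\mathtt C\le2^k\binom dk,$$ where $e$ is Euler's number. In particular both $\dim_{\mathrm{VC}}$ and $\dim_h$ of $\mathtt C$ and of $\mathtt C^+$ are $\Theta(d^k)$ with constants depending only on $k$.
   Context: Let $n=2^d$ and identify $[n]=\{0,\dots,n-1\}$ with $\{0,1\}^d$. Boolean variables $x_0,\dots,x_{d-1}$ are the coordinate functions $\{0,1\}^d\to\{0,1\}$; a literal is $x_i$ or its negation $\neg x_i$. A clause of size at most $k$ is a disjunction (OR) of at most $k$ literals (the empty clause being the constant $0$). A $k$-CNF is a conjunction (AND) of finitely many such clauses (the empty conjunction being the constant $1$); it is monotone if no negation occurs. The class of (monotone) $k$-CNFs is the set of functions $\{0,1\}^d\to\{0,1\}$ represented by (monotone) $k$-CNFs. Fix a field $\Bbbk$, $S=\Bbbk[x_{(i,b)}: i\in[n], b\in\{0,1\}]$; for a function class $\mathtt C\subseteq\{0,1\}^{[n]}$, $I^\star_{\mathtt C}=\langle\prod_{i\in[n]}x_{(i,1-f(i))}: f\in\mathtt C\rangle$ and $\dim_h\mathtt C:=\operatorname{projdim}_SI^\star_{\mathtt C}$. A set $U\subseteq[n]$ is shattered by $\mathtt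 C$ if every function $U\to\{0,1\}$ is a restriction of some $f\in\mathtt C$; $\dim_{\mathrm{VC}}\mathtt C$ is the maximal size of a shattered set. *)

(* Defs.v *)
From HB Require Import structures.
From mathcomp Require Import all_boot all_order all_algebra.
Set Implicit Arguments. Unset Strict Implicit. Unset Printing Implicit Defensive.
Import GRing.Theory.
Local Open Scope ring_scope.

(* mpoly R m = R[X_0,...,X_{m-1}], built as iterated univariate polynomials;
   X_(m-1) is the outermost variable. *)
Fixpoint mpoly (R : comNzRingType) (m : nat) : comNzRingType :=
  if m is m'.+1 then [the comNzRingType of {poly mpoly R m'}] else R.

(* the variable X_j in mpoly R m (equal to 0 if j >= m; never used so) *)
Fixpoint mvar (R : comNzRingType) (m j : nat) : mpoly R m :=
  match m return mpoly R m with
  | 0 => 0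
  | m'.+1 => if j == m' then 'X else (@mvar R m' j)%:P
  end.

Definition ideal_gen (S : comNzRingType) (G : S -> Prop) (s : S) : Prop :=
  exists (m : nat) (c g : 'I_m -> S), (forall i, G (g i)) /\
                          s = \sum_(i < m) c i * g i.

(* A finite free resolution of length <= p of the ideal I (given as a
   predicate on S):  0 -> S^(r p) -> ... -> S^(r 1) --d 0--> S^(r 0) --h--> I -> 0,
   with maps acting on row vectors by right multiplication, r j = 0 for j > p. *)
Definition free_res_le (S : comNzRingType) (I : S -> Prop) (p : nat) : Prop :=
  exists (r : nat -> nat) (h : 'cV[S]_(r 0%N))
         (dd : forall j : nat, 'M[S]_(r j.+1, r j)),
    (forall j, (p < j)%N -> r j = 0%N) /\
    (forall s, I s <-> exists v : 'rV[S]_(r 0%N), (v *m h) 0 0 = s) /\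
    (forall v : 'rV[S]_(r 0%N),
        v *m h = 0 <-> exists w : 'rV[S]_(r 1%N), w *m dd 0%N = v) /\
    (forall (j : nat) (v : 'rV[S]_(r j.+1)),
        v *m dd j = 0 <-> exists w : 'rV[S]_(r j.+2), w *m dd j.+1 = v).

Definition is_projdim (S : comNzRingType) (I : S -> Prop) (p : nat) : Prop :=
  free_res_le I p /\ forall q, free_res_le I q -> (p <= q)%N.

Definition fclass (n : nat) := {ffun 'I_n -> bool} -> Prop.

Definition xvar (K : fieldType) (n i : nat) (b : bool) : mpoly K (2 * n) :=
  @mvar K (2 * n) (2 * i + b).

Definition Istar (K : fieldType) (n : nat) (C : fclass n) : mpoly K (2 * n) -> Prop :=
  ideal_gen (fun s => exists2 f, C f &
                       s = \prod_(i < n) @xvar K n i (~~ f i)).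

Definition dim_h (K : fieldType) (n : nat) (C : fclass n) (p : nat) : Prop :=
  is_projdim (@Istar K n C) p.

Definition shattered (n : nat) (C : fclass n) (U : {set 'I_n}) : Prop :=
  forall g : {ffun 'I_n -> bool}, exists f, C f /\ {in U, f =1 g}.

Definition is_vcdim (n : nat) (C : fclass n) (v : nat) : Prop :=
  (exists U, shattered C U /\ #|U| = v) /\
  forall U, shattered C U -> (#|U| <= v)%N.

(* i in [2^d] is identified with its binary digits: x_j(i) = j-th bit of i *)
Definition coord (d : nat) (j : 'I_d) (i : 'I_(2 ^ d)) : bool := odd (i %/ 2 ^ j).

Definition literal (d : nat) := ('I_d * bool)%type.
Definition lit_eval d (l : literal d) (i : 'I_(2 ^ d)) : bool :=
  if l.2 then coord l.1 i else ~~ coord l.1 i.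
Definition clause_eval d (c : seq (literal d)) i : bool := has (fun l => lit_eval l i) c.
Definition cnf_eval d (F : seq (seq (literal d))) i : bool := all (fun c => clause_eval c i) F.

Definition is_kCNF d k (F : seq (seq (literal d))) : bool :=
  all (fun c => size c <= k)%N F.
Definition is_monotone d (F : seq (seq (literal d))) : bool :=
  all (fun c => all (fun l => l.2) c) F.

Definition kCNF (d k : nat) : fclass (2 ^ d) :=
  fun f => exists F, is_kCNF k F /\ forall i, f i = cnf_eval F i.
Definition kCNF_mono (d k : nat) : fclass (2 ^ d) :=
  fun f => exists F, is_kCNF k F /\ is_monotone F /\ forall i, f i = cnf_eval F i.

Arguments kCNF d k : clear implicits.
Arguments kCNF_mono d k : clear implicits.
Arguments dim_h K {n} C p.
Arguments Istar K {n} C.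

(* Main.v *)
(* Both classes consist of the conjunctions f_S of the subsets S of a fixed set of
   N clauses: all monotone clauses of size <= k, respectively all clauses on
   exactly k variables.

   Upper bound: for g <= h let J(cs, g, h) be the ideal generated by the monomials
   lcm(m_(f_S /\ g), m_(f_S /\ h)), S a subset of cs.  Adding a clause c to cs gives
   J(c :: cs, g, h) = J(cs, g, h) + J(cs, g /\ c, h /\ c), and these two ideals meet in
   J(cs, g /\ c, h).  By Mayer-Vietoris and induction J(cs, g, h) has projective
   dimension at most |cs|; for g = h = 1 this is I*_C.

   Lower bound: let U be shattered, and let the Koszul complex on the variables
   x_(u,b), u in U, resolve a module M.  Then Tor_|U|(I*_C, M) <> 0: the product over
   u in U of the cycles x_(u,1) e_(u,0) - x_(u,0) e_(u,1), multiplied by all the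
   variables outside U, has entries in I*_C of degree |U| in the variables of U, while
   boundaries with coefficients in I*_C have degree at least |U| + 1.  The points whose
   zero coordinates form a k-set are shattered by monotone k-CNFs.

   Numerical bound: k^k d^(d-k) sum_(i<=k) C(d,i) <= sum_i C(d,i) k^i d^(d-i)
   = (d + k)^d <= d^d e^k. *)
Require Import Defs.
From Stdlib Require Import Reals Classical Lra.
From HB Require Import structures.
From mathcomp Require Import all_boot all_order all_algebra.
Set Implicit Arguments. Unset Strict Implicit. Unset Printing Implicit Defensive.
Import GRing.Theory.

(** * Free resolutions: horseshoe lemma, Mayer-Vietoris, vanishing of Tor *)

Section Resolutions.
Variable S : comNzRingType.
Local Open Scope ring_scope.

Definition img m r (h : 'M[S]_(r, m)) (u : 'rV[S]_m) := exists v, v *m h = u.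
Definition ker m r (h : 'M[S]_(r, m)) (v : 'rV[S]_r) := v *m h = 0.

(* M has a free resolution of length at most n, phrased through iterated syzygies. *)
Fixpoint pdle (n m : nat) (M : 'rV[S]_m -> Prop) {struct n} : Prop :=
  exists (r : nat) (h : 'M[S]_(r, m)), (forall u, M u <-> img h u) /\
    match n with
    | 0 => forall v, ker h v -> v = 0
    | n'.+1 => pdle n' (ker h)
    end.

Lemma pdle_ext n m (M M' : 'rV[S]_m -> Prop) :
  (forall u, M u <-> M' u) -> pdle n M -> pdle n M'.
Proof.
by case: n => [|n] E [r [h [H1 H2]]]; exists r, h; split=> // u; rewrite -E.
Qed.

Lemma rV_size0 r (v : 'rV[S]_r) : r = 0%N -> v = 0.
Proof. by move=> r0; apply/rowP => -[i lt_ir]; exfalso; move: lt_ir; rewrite r0. Qed.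

Lemma res_pdle p m (M : 'rV[S]_m -> Prop) (r : nat -> nat) (h : 'M[S]_(r 0%N, m))
    (dd : forall j, 'M[S]_(r j.+1, r j)) :
  (forall j, (p < j)%N -> r j = 0%N) ->
  (forall u, M u <-> img h u) ->
  (forall v, ker h v <-> img (dd 0%N) v) ->
  (forall j v, ker (dd j) v <-> img (dd j.+1) v) -> pdle p M.
Proof.
elim: p m M r h dd => [|p IHp] m M r h dd r0 Mh hd ddE.
  exists (r 0%N), h; split=> // v /hd [w <-].
  by rewrite (rV_size0 w) ?mul0mx // r0.
exists (r 0%N), h; split=> //.
by apply: (IHp _ _ (fun j => r j.+1) (dd 0%N) (fun j => dd j.+1)) => // j ltpj; apply: r0.
Qed.

Lemma pdle_res p m (M : 'rV[S]_m -> Prop) : pdle p M ->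
  exists (r : nat -> nat) (h : 'M[S]_(r 0%N, m)) (dd : forall j, 'M[S]_(r j.+1, r j)),
  [/\ forall j, (p < j)%N -> r j = 0%N,
      forall u, M u <-> img h u,
      forall v, ker h v <-> img (dd 0%N) v &
      forall j v, ker (dd j) v <-> img (dd j.+1) v].
Proof.
elim: p m M => [|p IHp] m M [r [h [Mh]]].
  move=> h0; exists (fun j => if j is 0 then r else 0%N), h, (fun j => 0).
  split=> //; first by case.
    move=> v; split; first by move/h0->; exists 0; rewrite mulmx0.
    by case=> w <-; rewrite /ker mulmx0 mul0mx.
  move=> j v; split; last by rewrite /ker mulmx0.
  by rewrite [v]rV_size0 // => _; exists 0; rewrite mulmx0.
case/IHp=> r' [h' [dd' [r'0 Mh' h'dd ddE]]].
pose rr j := if j is j'.+1 then r' j' else r.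
exists rr, h.
exists (fun j => match j return 'M[S]_(rr j.+1, rr j) with 0 => h' | j'.+1 => dd' j' end).
by split=> //; [case=> // j; apply: r'0 | case].
Qed.

(** An ideal is a submodule of the free module of rank one, so the inductive notion [pdle] applies
    to it and to its syzygies alike. *)
Lemma free_res_leE (I : S -> Prop) p :
  free_res_le I p <-> pdle p (fun u : 'rV[S]_1 => I (u 0 0)).
Proof.
have rV1 (u : 'rV[S]_1) s : u 0 0 = s <-> u = s%:M.
  by split=> [<-|->]; [exact: mx11_scalar | rewrite mxE eqxx].
split=> [[r [h [dd [r0 [Ih [hdd ddE]]]]]] | /pdle_res [r [h [dd [r0 Ih hdd ddE]]]]].
  apply: (res_pdle (h := h) (dd := dd)) => // u; rewrite Ih.
  by split=> -[v]; [move/rV1; rewrite -mx11_scalar => e | move=> e]; exists v => //; rewrite e.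
exists r, h, dd; split=> //; split=> //.
move=> s; have := Ih s%:M; rewrite mxE eqxx mulr1n => ->.
by split=> -[v e]; exists v; apply/rV1.
Qed.

Lemma pdle0 n m : pdle n (fun u : 'rV[S]_m => u = 0).
Proof.
elim: n m => [|n IHn] m; exists 0%N, 0; (split;
  first by move=> u; split=> [->|[w <-]]; [exists 0|]; rewrite mulmx0).
  by move=> v _; apply: rV_size0.
apply: pdle_ext (IHn _) => u; split=> [->|_]; first by rewrite /ker mul0mx.
exact: rV_size0.
Qed.

Lemma pdleS n m (M : 'rV[S]_m -> Prop) : pdle n M -> pdle n.+1 M.
Proof.
elim: n m M => [|n IHn] m M [r [h [Mh h0]]]; exists r, h; split=> //; last exact: IHn.
by apply: pdle_ext (pdle0 _ _) => v; split=> [->|/h0 //]; rewrite /ker mul0mx.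
Qed.

(** Bounding the syzygies by [n] instead of [n - 1] includes the case [n = 0]; Mayer-Vietoris glues
    this kernel with another module of dimension at most [n]. *)
Lemma pdle_cover n m (M : 'rV[S]_m -> Prop) : pdle n M ->
  exists (r : nat) (h : 'M[S]_(r, m)), (forall u, M u <-> img h u) /\ pdle n (ker h).
Proof.
case: n => [|n] [r [h [Mh h0]]]; exists r, h; split=> //; last exact: pdleS.
by apply: pdle_ext (pdle0 _ _) => v; split=> [->|/h0 //]; rewrite /ker mul0mx.
Qed.

Lemma choose_rows m r (Q : 'I_r -> 'rV[S]_m -> Prop) :
  (forall i, exists u, Q i u) -> exists L : 'M[S]_(r, m), forall i, Q i (row i L).
Proof.
move/fin_all_exists => [f Qf]; exists (\matrix_i f i) => i.
by rewrite rowK.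
Qed.

Definition submod m (M : 'rV[S]_m -> Prop) :=
  [/\ M 0, forall u v, M u -> M v -> M (u + v) & forall c u, M u -> M (c *: u)].

Lemma submod_mulmx m r (M : 'rV[S]_m -> Prop) (L : 'M[S]_(r, m)) v :
  submod M -> (forall i, M (row i L)) -> M (v *m L).
Proof.
case=> M0 MD MZ ML; rewrite mulmx_sum_row.
by elim/big_rec: _ => // i u _ Mu; apply: MD => //; apply: MZ.
Qed.

Lemma ker_submod m r (h : 'M[S]_(r, m)) : submod (ker h).
Proof.
rewrite /ker; split=> [|u v|c u]; first by rewrite mul0mx.
  by rewrite mulmxDl => -> ->; rewrite addr0.
by rewrite -scalemxAl => ->; rewrite scaler0.
Qed.

(** Generators of [C] lift through [P] to the rows of [L]. An element of [B] differs from a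
    combination of these lifts by an element killed by [P], hence coming from [A]. *)
Lemma horseshoe_cover a b c (A : 'rV[S]_a -> Prop) (B : 'rV[S]_b -> Prop)
    (C : 'rV[S]_c -> Prop) (J : 'M[S]_(a, b)) (P : 'M[S]_(b, c))
    r1 (h1 : 'M[S]_(r1, a)) r2 (h2 : 'M[S]_(r2, c)) :
  submod B ->
  (forall u, B u /\ u *m P = 0 <-> exists2 w, A w & w *m J = u) ->
  (forall u, C u <-> exists2 w, B w & w *m P = u) ->
  (forall u, A u <-> img h1 u) -> (forall u, C u <-> img h2 u) ->
  exists L : 'M[S]_(r2, b), [/\ L *m P = h2, forall v, B (v *m L) &
    forall u, B u <-> img (col_mx (h1 *m J) L) u].
Proof.
move=> sB kerP imP Ah1 Ch2; have [B0 BD BZ] := sB.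
have [L LP] : exists L : 'M[S]_(r2, b), forall i, B (row i L) /\ row i L *m P = row i h2.
  apply: (choose_rows (Q := fun i u => B u /\ u *m P = row i h2)) => i; have /imP [w Bw wP] : C (row i h2).
    by apply/Ch2; exists (delta_mx 0 i); rewrite -rowE.
  by exists w.
have LPE : L *m P = h2 by apply/row_matrixP => i; rewrite row_mul; case: (LP i).
have BL v : B (v *m L) by apply: submod_mulmx => // i; case: (LP i).
exists L; split=> // u; split=> [Bu|[v <-]]; last first.
  rewrite -[v]hsubmxK mul_row_col mulmxA; apply: BD => //.
  have [] // : B (lsubmx v *m h1 *m J) /\ lsubmx v *m h1 *m J *m P = 0.
  by apply/kerP; exists (lsubmx v *m h1) => //; apply/Ah1; exists (lsubmx v).
have /Ch2 [y yE] : C (u *m P) by apply/imP; exists u.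
have /kerP [w Aw wJ] : B (u - y *m L) /\ (u - y *m L) *m P = 0.
  split; last by rewrite mulmxBl -mulmxA LPE yE subrr.
  by apply: BD => //; rewrite -scaleN1r; apply: BZ.
have /Ah1 [x xE] := Aw.
by exists (row_mx x y); rewrite mul_row_col mulmxA xE wJ subrK.
Qed.

(* The horseshoe lemma for 0 -> A -> B -> C -> 0, where A is embedded in B by
   right multiplication by J and B is mapped onto C by right multiplication by P. *)
Lemma horseshoe n a b c (A : 'rV[S]_a -> Prop) (B : 'rV[S]_b -> Prop)
    (C : 'rV[S]_c -> Prop) (J : 'M[S]_(a, b)) (P : 'M[S]_(b, c)) :
  submod B ->
  (forall u, A u -> u *m J = 0 -> u = 0) ->
  (forall u, B u /\ u *m P = 0 <-> exists2 w, A w & w *m J = u) ->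
  (forall u, C u <-> exists2 w, B w & w *m P = u) ->
  pdle n A -> pdle n C -> pdle n B.
Proof.
elim: n a b c A B C J P => [|n IHn] a b c A B C J P sB injJ kerP imP
  [r1 [h1 [Ah1 K1]]] [r2 [h2 [Ch2 K2]]].
all: have [L [LPE BL BE]] := horseshoe_cover sB kerP imP Ah1 Ch2.
all: have J0 (v : 'rV_r1) : v *m h1 *m J *m P = 0
   by case: (kerP (v *m h1 *m J)) => _ [] //; exists (v *m h1) => //; apply/Ah1; exists v.
all: have h20 (v : 'rV_(r1 + r2)) : v *m col_mx (h1 *m J) L = 0 -> rsubmx v *m h2 = 0
   by rewrite -{1}[v]hsubmxK mul_row_col mulmxA -LPE => /(congr1 (mulmx^~ P));
   rewrite mulmxDl J0 mul0mx add0r mulmxA.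
all: have injk (v : 'rV_r1) : v *m h1 *m J = 0 -> ker h1 v
   by apply: injJ; apply/Ah1; exists v.
all: exists (r1 + r2)%N, (col_mx (h1 *m J) L); split=> //.
  move=> v v0; have y0 := K2 _ (h20 _ v0); move: v0.
  rewrite /ker -[v]hsubmxK mul_row_col mulmxA y0 mul0mx addr0.
  by move/injk/K1->; rewrite row_mx0.
(* The kernels of the three covers again form a short exact sequence, embedded and projected
   blockwise. *)
apply: (IHn _ _ _ _ _ _ (row_mx 1%:M 0) (col_mx 0 1%:M) _ _ _ _ K1 K2).
- exact: ker_submod.
- by move=> u _ /eqP; rewrite mul_mx_row mulmx1 row_mx_eq0 => /andP [/eqP].
- move=> u; rewrite /ker -[u]hsubmxK !mul_row_col mulmxA !(mulmx0, mulmx1, add0r).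
  split=> [[/[swap] ->]|[w w0]].
    rewrite mul0mx addr0 => /injk k1; exists (lsubmx u) => //.
    by rewrite mul_mx_row mulmx1 mulmx0.
  rewrite mul_mx_row mulmx1 mulmx0 => /eq_row_mx [<- <-].
  by rewrite w0 !mul0mx addr0.
(* Surjectivity onto [ker h2]: [u *m L] is killed by [P], so it comes from [A] and is cancelled by a
   combination of the rows of [h1 *m J]. *)
move=> u; split=> [u0|[w w0 <-]].
  have /kerP [w Aw wJ] : B (- (u *m L)) /\ - (u *m L) *m P = 0.
    split; first by case: sB => _ _ BZ; rewrite -scaleN1r; apply: BZ.
    by rewrite mulNmx -mulmxA LPE u0 oppr0.
  have /Ah1 [x xE] := Aw.
  exists (row_mx x u); last by rewrite mul_row_col mulmx0 mulmx1 add0r.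
  by rewrite /ker mul_row_col mulmxA xE wJ addNr.
by rewrite -[w in w *m col_mx 0 _]hsubmxK mul_row_col mulmx0 mulmx1 add0r; apply: h20.
Qed.

Definition ideal (I : S -> Prop) :=
  [/\ I 0, forall a b, I a -> I b -> I (a + b) & forall c a, I a -> I (c * a)].

Lemma ideal_opp I a : ideal I -> I a -> I (- a).
Proof. by case=> _ _ IM Ia; rewrite -mulN1r; apply: IM. Qed.

Definition emb1 (I : S -> Prop) (u : 'rV[S]_1) := I (u 0 0).

(* Mayer-Vietoris: 0 -> I1 /\ I2 -> I1 (+) I2 -> I1 + I2 -> 0. *)
Lemma pdle_add n (I1 I2 I : S -> Prop) :
  ideal I1 -> ideal I2 ->
  (forall a, I a <-> exists b c, [/\ I1 b, I2 c & a = b + c]) ->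
  pdle n (emb1 I1) -> pdle n (emb1 I2) -> pdle n (emb1 (fun a => I1 a /\ I2 a)) ->
  pdle n.+1 (emb1 I).
Proof.
move=> id1 id2 IE p1 p2 p12.
have [I10 I1D I1M] := id1; have [I20 I2D I2M] := id2.
pose B (u : 'rV[S]_(1 + 1)) := emb1 I1 (lsubmx u) /\ emb1 I2 (rsubmx u).
have sB : submod B.
  rewrite /B /emb1; split=> [|u v|c u]; rewrite !mxE //.
    by move=> [? ?] [? ?]; split; [apply: I1D | apply: I2D].
  by move=> [? ?]; split; [apply: I1M | apply: I2M].
(* I1 (+) I2 is an extension of I2 by I1. *)
have pB : pdle n B.
  apply: (horseshoe (J := row_mx 1%:M 0) (P := col_mx 0 1%:M) sB _ _ _ p1 p2).
  - by move=> u _ /eqP; rewrite mul_mx_row mulmx1 row_mx_eq0 => /andP [/eqP].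
  - move=> u; rewrite /B -[u]hsubmxK row_mxKl row_mxKr mul_row_col !(mulmx0, mulmx1, add0r).
    split=> [[[u1 _] ->]|[w w1]].
      by exists (lsubmx u) => //; rewrite mul_mx_row mulmx1 mulmx0.
    by rewrite mul_mx_row mulmx1 mulmx0 => /eq_row_mx [<- <-]; rewrite /emb1 mxE.
  move=> u; split=> [u2|[w [_ w2]]].
    exists (row_mx 0 u); last by rewrite mul_row_col !(mulmx0, mulmx1, add0r).
    by rewrite /B row_mxKl row_mxKr /emb1 mxE.
  by rewrite -[w]hsubmxK mul_row_col !(mulmx0, mulmx1, add0r) row_mxKr in w2 * => <-.
pose P : 'M[S]_(1 + 1, 1) := col_mx 1%:M 1%:M.
pose A (u : 'rV[S]_(1 + 1)) := B u /\ u *m P = 0.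
have PE (u : 'rV_(1 + 1)) : u *m P = lsubmx u + rsubmx u.
  by rewrite -{1}[u]hsubmxK mul_row_col !mulmx1.
(* The kernel of addition consists of the pairs (a, -a) with a in both ideals; the first projection
   is injective on it and identifies it with the intersection. *)
have pA : pdle n A.
  apply: (horseshoe (A := fun u : 'rV[S]_0 => u = 0) (C := emb1 (fun a => I1 a /\ I2 a))
     (J := 0) (P := col_mx 1%:M 0)) => //; last exact: pdle0.
  - split; first by split; [case: sB | rewrite mul0mx].
      move=> u v [Bu u0] [Bv v0]; split; last by rewrite mulmxDl u0 v0 addr0.
      by case: sB => _ BD _; apply: BD.
    move=> c u [Bu u0]; split; last by rewrite -scalemxAl u0 scaler0.
    by case: sB => _ _ BZ; apply: BZ.
  - move=> u; split=> [[[Bu]]|[w -> <-]]; last first.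
      by rewrite !mul0mx; split=> //; split; [case: sB | rewrite mul0mx].
    rewrite PE -{3}[u]hsubmxK mul_row_col !(mulmx0, mulmx1, addr0) => e ul.
    exists 0 => //; rewrite mul0mx -[u]hsubmxK ul; move: e; rewrite ul add0r => ->.
    by rewrite row_mx0.
  move=> u; split=> [[u1 u2]|[w [[w1 w2]]]].
    exists (row_mx u (- u)); last by rewrite mul_row_col !(mulmx0, mulmx1, addr0).
    rewrite /A PE /B row_mxKl row_mxKr subrr; split=> //; split=> //.
    by rewrite /emb1 mxE; apply: ideal_opp.
  rewrite PE => e.
  rewrite -{1}[w]hsubmxK mul_row_col !(mulmx0, mulmx1, addr0) => <-.
  split=> //; move/eqP: e; rewrite addr_eq0 => /eqP ->; rewrite mxE.
  exact: ideal_opp.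
(* A free cover [h] of I1 (+) I2 followed by addition covers I, and the kernel of the composite is
   an extension of [A] by [ker h]. *)
have [r [h [Bh ph]]] := pdle_cover pB.
exists r, (h *m P); split.
  move=> u; rewrite /emb1 IE; split=> [[b [c [Ib Ic bc]]]|[v vE]].
    have /Bh [v vE] : B (row_mx b%:M c%:M).
      by rewrite /B row_mxKl row_mxKr /emb1 !mxE.
    exists v; rewrite mulmxA vE PE row_mxKl row_mxKr.
    by rewrite [u]mx11_scalar bc raddfD.
  have [b c] : B (v *m h) by apply/Bh; exists v.
  exists (lsubmx (v *m h) 0 0), (rsubmx (v *m h) 0 0); split=> //.
  by rewrite -vE mulmxA PE mxE.
apply: (horseshoe (J := 1%:M) (P := h) (ker_submod _) _ _ _ ph pA).
- by move=> u _; rewrite mulmx1.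
- move=> u; split=> [[_ u0]|[w w0]]; first by exists u => //; rewrite mulmx1.
  by rewrite mulmx1 => <-; rewrite /ker mulmxA w0 mul0mx.
move=> u; split=> [[/Bh [v vE] u0]|[w w0 <-]].
  by exists v => //; rewrite /ker mulmxA vE.
by split; [apply/Bh; exists w | rewrite -mulmxA].
Qed.

(* Tor_t(M, -) = 0 for t > pd M, computed with a fixed exact complex D of free
   modules (column vectors, D acting on the left). *)
Lemma pdle_acyclic (s : nat -> nat) (D : forall j, 'M[S]_(s j, s j.+1))
    (DD0 : forall j, D j *m D j.+1 = 0)
    (exD : forall j c (Y : 'M[S]_(s j.+1, c)), D j *m Y = 0 -> exists W, Y = D j.+1 *m W)
    q m (M : 'rV[S]_m -> Prop) t (X : 'M[S]_(s t.+1, m)) :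
  submod M -> pdle q M -> (q <= t)%N -> (forall i, M (row i X)) -> D t *m X = 0 ->
  exists2 W : 'M[S]_(s t.+2, m), (forall i, M (row i W)) & X = D t.+1 *m W.
Proof.
elim: q m M t X => [|q IHq] m M t X sM [r [h [Mh hK]]] qt MX DX.
(* The cycle is lifted to the free cover. For [q = 0] the cover is injective, so the lift is itself
   a cycle. *)
all: have [Y YX] : exists Y : 'M[S]_(s t.+1, r), forall i, row i Y *m h = row i X
  by apply: (choose_rows (Q := fun i u => u *m h = row i X)) => i; apply/Mh.
all: have YE : Y *m h = X by apply/row_matrixP => i; rewrite row_mul.
  have DY0 : D t *m Y = 0.
    by apply/row_matrixP => i; rewrite row0; apply: hK; rewrite /ker -row_mul -mulmxA YE DX row0.
  have [W WE] := exD _ _ _ DY0; exists (W *m h); last by rewrite mulmxA -WE.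
  by move=> i; apply/Mh; exists (row i W); rewrite row_mul.
case: t qt X MX DX Y YX YE => // t qt X MX DX Y YX YE.
(* Dimension shifting: D Y is a cycle over the syzygies, one degree lower, so it equals D W with [W]
   over the syzygies. Then Y - W is a cycle over a free module, hence a boundary, and [h] kills
   [W]. *)
have [||W WK WE] := IHq _ _ t (D t.+1 *m Y) (ker_submod h) hK qt.
- by move=> i; rewrite /ker -row_mul -mulmxA YE DX row0.
- by rewrite mulmxA DD0 mul0mx.
have [|V VE] := exD _ _ (Y - W); first by rewrite mulmxBr -WE subrr.
exists (V *m h).
  by move=> i; apply/Mh; exists (row i V); rewrite row_mul.
rewrite mulmxA -VE mulmxBl YE.
have -> : W *m h = 0 by apply/row_matrixP => i; rewrite row_mul row0; apply: WK.
by rewrite subr0.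
Qed.

End Resolutions.

(** * Coefficients, monomials and monomial ideals in iterated polynomial rings *)

Section Supports.
Variable R : comNzRingType.
Local Open Scope ring_scope.

(** Exponents are functions on all of [nat], read only below [m], so that their type does not change
    in the recursion on the number of variables. *)
Fixpoint mcoef (m : nat) : mpoly R m -> (nat -> nat) -> R :=
  match m return mpoly R m -> (nat -> nat) -> R with
  | 0 => fun a _ => a
  | m'.+1 => fun a al => mcoef (a : {poly mpoly R m'})`_(al m') al
  end.

Definition upd (al : nat -> nat) j i : nat -> nat := fun l => if l == j then i else al l.
Definition inc (al : nat -> nat) j : nat -> nat := upd al j (al j).+1.

Lemma mcoef_ext m (a : mpoly R m) al be :
  (forall j, (j < m)%N -> al j = be j) -> mcoef a al = mcoef a be.
Proof.
elim: m a => //= m IHm a e; rewrite e //; apply: IHm => j lt_jm.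
by apply: e; apply: ltnW.
Qed.

Lemma mcoef_upd m (a : mpoly R m) al i : mcoef a (upd al m i) = mcoef a al.
Proof. by apply: mcoef_ext => j lt_jm; rewrite /upd ltn_eqF. Qed.

Lemma mcoef0 m al : mcoef (0 : mpoly R m) al = 0.
Proof. by elim: m => //= m IHm; rewrite coef0. Qed.

Lemma mcoefD m (a b : mpoly R m) al : mcoef (a + b) al = mcoef a al + mcoef b al.
Proof. by elim: m a b => //= m IHm a b; rewrite coefD IHm. Qed.

Lemma mcoefN m (a : mpoly R m) al : mcoef (- a) al = - mcoef a al.
Proof. by elim: m a => //= m IHm a; rewrite coefN IHm. Qed.

Lemma mcoef_inj m (a : mpoly R m) : (forall al, mcoef a al = 0) -> a = 0.
Proof.
elim: m a => [|m IHm] a a0 /=; first exact: (a0 (fun _ => 0%N)).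
apply/polyP => i; rewrite coef0; apply: IHm => al.
by have := a0 (upd al m i); rewrite /= {1}/upd eqxx mcoef_upd.
Qed.

Lemma mcoef_sum m I (r : seq I) (F : I -> mpoly R m) al :
  mcoef (\sum_(i <- r) F i) al = \sum_(i <- r) mcoef (F i) al.
Proof.
by elim: r => [|i r IHr]; rewrite ?big_nil ?mcoef0 // !big_cons mcoefD IHr.
Qed.

Lemma sum_neq0 (V : nmodType) n (F : 'I_n -> V) :
  \sum_(i < n) F i <> 0 -> exists i, F i <> 0.
Proof.
move=> F0; apply: NNPP => nF; apply: F0; apply: big1 => i _.
by apply: NNPP => Fi; apply: nF; exists i.
Qed.

Lemma mcoefM m (a b : mpoly R m) al : mcoef (a * b) al <> 0 ->
  exists be ga, [/\ forall j, al j = (be j + ga j)%N, mcoef a be <> 0 & mcoef b ga <> 0].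
Proof.
elim: m a b al => [|m IHm] a b al /=.
  move=> ab0; exists al, (fun _ => 0%N); split=> [j|a0|b0].
  - by rewrite addn0.
  - by apply: ab0; rewrite a0 mul0r.
  - by apply: ab0; rewrite b0 mulr0.
rewrite coefM mcoef_sum => /sum_neq0 [[k lt_k] /=] /IHm [be [ga [e ane bne]]].
(* The inductive exponents carry no information at coordinate [m]; there they are reset to the two
   degrees in the outermost variable. *)
exists (upd be m k), (upd ga m (al m - k)); split.
- by move=> j; rewrite /upd; case: eqP => [->|_]; rewrite ?subnKC.
- by rewrite {1}/upd eqxx mcoef_upd.
- by rewrite {1}/upd eqxx mcoef_upd.
Qed.

Lemma mcoef_mvar_inc m j (a : mpoly R m) al : (j < m)%N ->
  mcoef (mvar R m j * a) (inc al j) = mcoef a al.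
Proof.
elim: m a => // m IHm a; rewrite ltnS leq_eqVlt /= => /orP[/eqP ->|lt_jm].
  by rewrite eqxx /inc {1}/upd eqxx coefXM /= mcoef_upd.
rewrite ltn_eqF // coefCM IHm // /inc /upd.
by rewrite (gtn_eqF lt_jm).
Qed.

Lemma mcoef_mvar m j al : (j < m)%N -> mcoef (mvar R m j) al <> 0 -> (0 < al j)%N.
Proof.
elim: m => // m IHm; rewrite ltnS leq_eqVlt /= => /orP[/eqP ->|lt_jm].
  by rewrite eqxx coefX; case: (al m) => //=; rewrite mcoef0.
rewrite ltn_eqF // coefC; case: eqP => [_|_]; first exact: IHm.
by rewrite mcoef0.
Qed.

Fixpoint mono (m : nat) (al : nat -> nat) : mpoly R m :=
  match m return mpoly R m with
  | 0 => 1
  | m'.+1 => (mono m' al)%:P * 'X^(al m')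
  end.

Lemma mono_ext m al be :
  (forall j, (j < m)%N -> al j = be j) -> mono m al = mono m be.
Proof.
elim: m => //= m IHm e; rewrite e // IHm // => j lt_jm.
by apply: e; apply: ltnW.
Qed.

Lemma mono_upd m al i : mono m (upd al m i) = mono m al.
Proof. by apply: mono_ext => j lt_jm; rewrite /upd ltn_eqF. Qed.

Lemma mono_inc m j al : (j < m)%N -> mono m (inc al j) = mvar R m j * mono m al.
Proof.
elim: m => // m IHm; rewrite ltnS leq_eqVlt /= => /orP[/eqP ->|lt_jm].
  by rewrite eqxx mono_upd /inc /upd eqxx exprS mulrCA.
rewrite ltn_eqF // IHm // /inc /upd (gtn_eqF lt_jm) polyCM.
by rewrite mulrA.
Qed.

Lemma mono_prod m al js : uniq js ->
  (forall j, j \in js -> (j < m)%N && (0 < al j)%N) ->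
  exists c, mono m al = c * \prod_(j <- js) mvar R m j.
Proof.
elim: js al => [|j js IHjs] al /=; first by exists (mono m al); rewrite big_nil mulr1.
case/andP=> jjs ujs H; have /andP[lt_jm al0] := H j (mem_head _ _).
have [||c ce] := IHjs (upd al j (al j).-1) => //.
  move=> l l_js; rewrite /upd; have := H l; rewrite inE l_js orbT => /(_ isT) /andP[-> al1].
  by case: eqP => // e; rewrite -e l_js in jjs.
exists c; rewrite big_cons mulrCA -ce -mono_inc //; apply: mono_ext => l _.
by rewrite /inc /upd eqxx; case: eqP => // ->; rewrite prednK.
Qed.

Lemma mcoef_mono m al be : mcoef (mono m al) be <> 0 ->
  forall j, (j < m)%N -> al j = be j.
Proof.
elim: m => // m IHm /=; rewrite coefCM coefXn.
case: eqP => [e|_]; last by rewrite mulr0 mcoef0.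
rewrite mulr1 => /IHm E j; rewrite ltnS leq_eqVlt => /orP[/eqP -> //|]; exact: E.
Qed.

Lemma mcoef_mono_self m al : mcoef (mono m al) al = 1.
Proof. by elim: m => //= m IHm; rewrite coefCM coefXn eqxx mulr1. Qed.

(** For [P] upward closed this is the monomial ideal spanned by the monomials with exponent in [P].
    Sums of such ideals become disjunctions, intersections become conjunctions. *)
Definition supp m (P : (nat -> nat) -> Prop) (a : mpoly R m) :=
  forall al, mcoef a al <> 0 -> P al.

Definition upclosed m (P : (nat -> nat) -> Prop) :=
  forall al be, (forall j, (j < m)%N -> (al j <= be j)%N) -> P al -> P be.

Lemma supp0 m P : supp P (0 : mpoly R m).
Proof. by move=> al; rewrite mcoef0. Qed.

Lemma suppD m P (a b : mpoly R m) : supp P a -> supp P b -> supp P (a + b).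
Proof.
move=> Pa Pb al; rewrite mcoefD => ab; case: (classic (mcoef a al = 0)) => [a0|/Pa //].
by apply: Pb => b0; apply: ab; rewrite a0 b0 addr0.
Qed.

Lemma suppN m P (a : mpoly R m) : supp P a -> supp P (- a).
Proof. by move=> Pa al; rewrite mcoefN => a0; apply: Pa => e; apply: a0; rewrite e oppr0. Qed.

Lemma supp_weak m (P Q : (nat -> nat) -> Prop) (a : mpoly R m) :
  (forall al, P al -> Q al) -> supp P a -> supp Q a.
Proof. by move=> PQ Pa al /Pa /PQ. Qed.

Lemma suppM m (P Q T : (nat -> nat) -> Prop) (a b : mpoly R m) :
  (forall be ga, P be -> Q ga -> T (fun j => be j + ga j)%N) ->
  upclosed m T -> supp P a -> supp Q b -> supp T (a * b).
Proof.
move=> PQT upT Pa Qb al /mcoefM [be [ga [e /Pa Pbe /Qb Qga]]].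
by apply: upT (PQT _ _ Pbe Qga) => j _; rewrite e.
Qed.

Lemma supp_ideal m P : upclosed m P -> ideal (@supp m P).
Proof.
move=> upP; split; [exact: supp0 | by move=> a b; exact: suppD |].
move=> c a Pa; apply: (suppM (P := fun _ => True) _ upP _ Pa) => // be ga _.
by apply: upP => j _; rewrite leq_addl.
Qed.

Lemma supp_mono m P al : upclosed m P -> P al -> supp P (mono m al).
Proof. by move=> upP Pal be /mcoef_mono e; apply: upP Pal => j /e ->. Qed.

Lemma ideal_sum (S : comNzRingType) (J : S -> Prop) I (r : seq I) (F : I -> S) :
  ideal J -> (forall i, J (F i)) -> J (\sum_(i <- r) F i).
Proof. by case=> J0 JD _ JF; elim/big_rec: _ => // i x _; apply: JD. Qed.

(** A polynomial is a combination of its own monomials, so every ideal containing these contains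
    it. *)
Lemma supp_gen m P (J : mpoly R m -> Prop) a : ideal J ->
  (forall al, P al -> J (mono m al)) -> supp P a -> J a.
Proof.
elim: m P J a => [|m IHm] P J a idJ JP Pa.
  have [J0 _ JM] := idJ.
  case: (classic (a = 0)) => [-> //|a0]; rewrite -[a]mulr1; apply: JM.
  by apply: (JP (fun _ => 0%N)); apply: Pa.
rewrite -[a : {poly _}]coefK poly_def; apply: ideal_sum => // i.
rewrite -mul_polyC.
(* The coefficients allowed at the [i]-th power of the outermost variable form an ideal again, with
   one variable fewer. *)
pose J' (b : mpoly R m) := J (b%:P * 'X^i).
apply: (IHm (fun al => P (upd al m i)) J').
- have [J0 JD JM] := idJ; split; first by rewrite /J' polyC0 mul0r.
    by move=> b c Jb Jc; rewrite /J' polyCD mulrDl; apply: JD.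
  by move=> b c Jc; rewrite /J' polyCM -mulrA; apply: JM.
- by move=> al /JP /=; rewrite mono_upd /upd eqxx.
move=> al ne; apply: Pa => /=.
by rewrite {1}/upd eqxx mcoef_upd.
Qed.

Lemma supp_or m P Q (a : mpoly R m) : upclosed m P -> upclosed m Q ->
  supp (fun al => P al \/ Q al) a <-> exists b c, [/\ supp P b, supp Q c & a = b + c].
Proof.
move=> upP upQ; split; last first.
  case=> b [c [Pb Qc ->]]; apply: suppD.
    by apply: supp_weak Pb => al; left.
  by apply: supp_weak Qc => al; right.
pose J (x : mpoly R m) := exists b c, [/\ supp P b, supp Q c & x = b + c].
apply: (supp_gen (J := J)).
  split; first by exists 0, 0; rewrite addr0; split=> //; apply: supp0.
    move=> x y [b [c [Pb Qc ->]]] [b' [c' [Pb' Qc' ->]]].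
    by exists (b + b'), (c + c'); split; [exact: suppD | exact: suppD | rewrite addrACA].
  move=> x y [b [c [Pb Qc ->]]]; exists (x * b), (x * c); rewrite mulrDr.
  have [_ _ PM] := supp_ideal upP; have [_ _ QM] := supp_ideal upQ.
  by split=> //; [apply: PM | apply: QM].
move=> al [Pal|Qal].
  by exists (mono m al), 0; rewrite addr0; split=> //; [exact: supp_mono | exact: supp0].
by exists 0, (mono m al); rewrite add0r; split=> //; [exact: supp0 | exact: supp_mono].
Qed.

Lemma upclosed_all m (js : seq nat) : (forall j, j \in js -> (j < m)%N) ->
  upclosed m (fun al => forall j, j \in js -> (0 < al j)%N).
Proof. by move=> jm al be le_ab al0 j jjs; apply: leq_trans (le_ab _ (jm _ jjs)); apply: al0. Qed.

Lemma supp_prod m (js : seq nat) : (forall j, j \in js -> (j < m)%N) ->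
  supp (fun al => forall j, j \in js -> (0 < al j)%N) (\prod_(j <- js) mvar R m j).
Proof.
elim: js => [|i js IHjs] jm; first by move=> al _ j.
rewrite big_cons.
apply: (suppM (P := fun al => (0 < al i)%N) (Q := fun al => forall j, j \in js -> (0 < al j)%N)).
- move=> be ga bi gj j; rewrite inE addn_gt0 => /orP[/eqP -> | /gj ->]; by rewrite ?bi ?orbT.
- exact: upclosed_all.
- by move=> al; apply: mcoef_mvar; apply: jm; rewrite mem_head.
- by apply: IHjs => j jjs; apply: jm; rewrite inE jjs orbT.
Qed.

Lemma supp_allE m (js : seq nat) a : uniq js -> (forall j, j \in js -> (j < m)%N) ->
  supp (fun al => forall j, j \in js -> (0 < al j)%N) a <->
  exists c, a = c * \prod_(j <- js) mvar R m j.
Proof.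
move=> ujs jm; split; last first.
  case=> c ->; have [_ _ IM] := supp_ideal (upclosed_all jm).
  by apply: IM; apply: supp_prod.
apply: (supp_gen (J := fun x => exists c, x = c * _)) => [|al al0].
  split; first by exists 0; rewrite mul0r.
    by move=> _ _ [c ->] [c' ->]; exists (c + c'); rewrite mulrDl.
  by move=> x _ [c ->]; exists (x * c); rewrite mulrA.
by apply: mono_prod => // j jjs; rewrite jm //= al0.
Qed.

Lemma mvar_prod_reg m (js : seq nat) a : (forall j, j \in js -> (j < m)%N) ->
  (\prod_(j <- js) mvar R m j) * a = 0 -> a = 0.
Proof.
elim: js a => [|i js IHjs] a jm; first by rewrite big_nil mul1r.
rewrite big_cons -mulrA => e; apply: IHjs => [j jjs|].
  by apply: jm; rewrite inE jjs orbT.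
apply: mcoef_inj => al; rewrite -(@mcoef_mvar_inc _ i); last by apply: jm; rewrite mem_head.
by rewrite e mcoef0.
Qed.

End Supports.

(** * Ideals of function classes and the upper bound on projective dimension *)

Section FunctionIdeals.
Variables (K : fieldType) (n : nat).
Implicit Types (C : fclass n) (g h : 'I_n -> bool) (al : nat -> nat).

Definition vidx (i : nat) (b : bool) : nat := 2 * i + b.

Lemma vidx_lt (i : 'I_n) b : vidx i b < 2 * n.
Proof.
rewrite /vidx; case: b; rewrite ?addn1 ?addn0; last by rewrite ltn_pmul2l.
by rewrite !mul2n -doubleS ltn_Sdouble -ltnS ltnS.
Qed.

Lemma vidx_inj (i i' : nat) b b' : vidx i b = vidx i' b' -> (i, b) = (i', b').
Proof.
rewrite /vidx !mul2n !(addnC _.*2) => e.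
have eb : b = b' by have := congr1 odd e; rewrite !oddD !odd_double !addbF !oddb.
by move: e; rewrite eb => /addnI /double_inj ->.
Qed.

(* The generator of Istar attached to f divides the monomial with exponent al. *)
Definition dominates al (f : 'I_n -> bool) := forall i : 'I_n, 0 < al (vidx i (~~ f i)).

Definition vars (f : 'I_n -> bool) := [seq vidx (i : 'I_n) (~~ f i) | i <- enum 'I_n].

Lemma upclosed_dominates f : upclosed (2 * n) (dominates^~ f).
Proof.
by move=> al be le_ab fal i; apply: leq_trans (fal i) (le_ab _ (vidx_lt _ _)).
Qed.

Lemma Istar_supp C (a : mpoly K (2 * n)) :
  Istar K C a <-> supp (fun al => exists2 f, C f & dominates al f) a.
Proof.
have up : upclosed (2 * n) (fun al => exists2 f, C f & dominates al f).
  by move=> al be le_ab [f Cf fal]; exists f => //; apply: upclosed_dominates fal.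
have prodE (f : 'I_n -> bool) : (\prod_(i < n) @xvar K n i (~~ f i) =
    \prod_(j <- vars f) mvar K (2 * n) j)%R.
  by rewrite big_map big_enum.
split.
  case=> m [c [g [Gg ->]]].
  apply: (ideal_sum _ (supp_ideal K up)) => i; have [f Cf ->] := Gg i.
  have [_ _ IM] := supp_ideal K up; apply: IM; rewrite prodE.
  apply: supp_weak; last apply: supp_prod.
    by move=> al H; exists f => // j; apply: H; apply: map_f; rewrite mem_enum.
  by move=> j /mapP [l _ ->]; apply: vidx_lt.
have GI c f : C f -> Istar K C (c * \prod_(i < n) @xvar K n i (~~ f i))%R.
  move=> Cf; exists 1, (fun _ => c), (fun _ => (\prod_(i < n) @xvar K n i (~~ f i))%R).
  by rewrite big_ord1; split=> // _; exists f.
apply: supp_gen => [|al [f Cf fal]].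
  split.
  - by exists 0, (fun _ => 0%R), (fun _ => 0%R); rewrite big_ord0; split=> // -[].
  - move=> _ _ [m [c [g [Gg ->]]]] [m' [c' [g' [Gg' ->]]]].
    exists (m + m')%N, (fun i => match split i with inl j => c j | inr j => c' j end),
      (fun i => match split i with inl j => g j | inr j => g' j end).
    split; first by move=> i; case: split => j.
    by rewrite big_split_ord /=; congr (_ + _)%R; apply: eq_bigr => i _;
      [rewrite (unsplitK (inl i)) | rewrite (unsplitK (inr i))].
  - move=> x _ [m [c [g [Gg ->]]]]; exists m, (fun i => x * c i)%R, g; split=> //.
    by rewrite big_distrr; apply: eq_bigr => i _ /=; rewrite mulrA.
have [||c ->] := @mono_prod K (2 * n) al (vars f).
- by rewrite map_inj_uniq ?enum_uniq // => i j /vidx_inj [/val_inj].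
- by move=> j /mapP [i _ ->]; rewrite vidx_lt fal.
by rewrite -prodE; apply: GI.
Qed.

Definition meet_fun (S : seq {ffun 'I_n -> bool}) (i : 'I_n) : bool := all (fun c : {ffun _ -> _} => c i) S.

(* Exponents of the monomials divisible, for some S contained in cs, by the lcm
   of the monomials of [meet S /\ g] and [meet S /\ h]. *)
Definition interval_exp (cs : seq {ffun 'I_n -> bool}) g h al :=
  exists2 S, {subset S <= cs} &
    dominates al (fun i => meet_fun S i && g i) /\ dominates al (fun i => meet_fun S i && h i).

Lemma upclosed_interval_exp cs g h : upclosed (2 * n) (interval_exp cs g h).
Proof.
move=> al be le_ab [S Scs [Sg Sh]]; exists S => //.
by split; [apply: upclosed_dominates Sg | apply: upclosed_dominates Sh].
Qed.

Lemma dominates_ext al f f' : f =1 f' -> dominates al f -> dominates al f'.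
Proof. by move=> e fal i; rewrite -e. Qed.

Lemma dominates_between al (f f' g : 'I_n -> bool) : dominates al f -> dominates al f' ->
  (forall i, g i = f i \/ g i = f' i) -> dominates al g.
Proof. by move=> df df' H i; case: (H i) => ->. Qed.

(** The subsets are sorted by whether they contain [c]; if so, [c] is moved out of the conjunction
    into both ends. This is the decomposition of the ideal as a sum. *)
Lemma interval_exp_cons c cs g h al : interval_exp (c :: cs) g h al <->
  interval_exp cs g h al \/
  interval_exp cs (fun i => g i && c i) (fun i => h i && c i) al.
Proof.
split=> [[S Scs [Sg Sh]]|[[S Scs SP]|[S Scs [Sg Sh]]]].
- case cS: (c \in S); last first.
    left; exists S => // x xS; have := Scs x xS; rewrite inE => /orP[/eqP xc|//].
    by rewrite -xc xS in cS.
  have E i : meet_fun S i = c i && meet_fun (filter (predC1 c) S) i.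
    apply/allP/andP => [H|[ci /allP H] x xS].
      split; first exact: H.
      by apply/allP => x; rewrite mem_filter => /andP[_ /H].
    case: (eqVneq x c) => [->//|xc]; apply: H.
    by rewrite mem_filter xS andbT.
  right; exists (filter (predC1 c) S).
    move=> x; rewrite mem_filter => /andP[/= xc /Scs]; rewrite inE.
    by rewrite (negbTE xc).
  by split; [move: Sg | move: Sh]; apply: dominates_ext => i;
    rewrite E [c i && _]andbC -andbA [c i && _]andbC.
- by exists S => // x /Scs; rewrite inE => ->; rewrite orbT.
exists (c :: S); first by move=> x; rewrite !inE => /orP[->//|/Scs ->]; rewrite orbT.
by split; [move: Sg | move: Sh]; apply: dominates_ext => i;
  rewrite [meet_fun (c :: S) i]/= [c i && _]andbC -andbA [c i && _]andbC.
Qed.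

(** Domination is a pointwise condition on values. From left to right, each value of the two
    conjunctions over [S ++ T] is a value of one of the four given functions. From right to left, S
    /\ g and S /\ h /\ c lie between S /\ g /\ c and S /\ h, so at each point they take one of these
    two values. *)
Lemma interval_exp_and c cs g h al : (forall i, g i -> h i) ->
  interval_exp cs g h al /\ interval_exp cs (fun i => g i && c i) (fun i => h i && c i) al <->
  interval_exp cs (fun i => g i && c i) h al.
Proof.
move=> gh; split=> [[[S Scs [Sg Sh]] [T Tcs [Tg Th]]]|[S Scs [Sgc Sh]]].
  exists (S ++ T); first by move=> x; rewrite mem_cat => /orP[/Scs|/Tcs].
  split=> i; have := Sg i; have := Sh i; have := Tg i; have := Th i;
    have := gh i; rewrite /meet_fun all_cat;
    by case: (all _ S); case: (all _ T); case: (g i); case: (h i); case: (c i) => //= /(_ isT).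
by split; exists S => //; split;
  apply: (dominates_between Sgc Sh) => i; have := gh i;
  case: (meet_fun S i); case: (g i); case: (h i); case: (c i);
  by [left | right | move=> /(_ isT)].
Qed.

(** Two ends are carried along because the intersection in Mayer-Vietoris has the ends g /\ c and h,
    which may differ even when g = h. *)
Lemma pdle_interval cs g h : (forall i, g i -> h i) ->
  pdle (size cs) (emb1 (supp (R := K) (m := 2 * n) (interval_exp cs g h))).
Proof.
elim: cs g h => [|c cs IHcs] g h gh.
  (* Without clauses the ideal is principal, generated by the lcm of two squarefree monomials.
     Products of variables are nonzerodivisors, so it is free of rank one. *)
  pose js := undup (vars g ++ vars h).
  have jm j : j \in js -> j < 2 * n.
    by rewrite mem_undup mem_cat => /orP[] /mapP[i _ ->]; apply: vidx_lt.
  have jsP al : interval_exp [::] g h al <-> (forall j, j \in js -> 0 < al j).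
    split=> [[S S0 [Sg Sh]] j|H].
      have {}S0 : S = [::] by case: S S0 {Sg Sh} => // x S /(_ x (mem_head _ _)).
      rewrite mem_undup mem_cat S0 in Sg Sh * => /orP[] /mapP[i _ ->]; [exact: Sg | exact: Sh].
    exists [::] => //; split=> i /=; apply: H; rewrite mem_undup mem_cat; apply/orP;
      [left | right]; by apply: map_f; rewrite mem_enum.
  exists 1%N, (\prod_(j <- js) mvar K (2 * n) j)%:M%R; split=> [u|v].
    have -> : emb1 (supp (interval_exp [::] g h)) u <->
        emb1 (supp (fun al => forall j, j \in js -> 0 < al j)) u.
      by split; apply: supp_weak => al /jsP.
    rewrite /emb1 supp_allE ?undup_uniq //; split=> [[c e]|[v <-]].
      by exists c%:M%R; rewrite -scalar_mxM -e -mx11_scalar.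
    by exists (v 0 0)%R; rewrite [v]mx11_scalar -scalar_mxM !mxE.
  rewrite /ker [v]mx11_scalar -scalar_mxM => /matrixP /(_ 0 0)%R.
  by rewrite !mxE eqxx !mulr1n mulrC => /(mvar_prod_reg jm) ->; apply/matrixP => i j; rewrite !mxE mul0rn.
apply: (pdle_add (I1 := supp (interval_exp cs g h))
   (I2 := supp (interval_exp cs (fun i => g i && c i) (fun i => h i && c i)))).
- exact/supp_ideal/upclosed_interval_exp.
- exact/supp_ideal/upclosed_interval_exp.
- move=> a; rewrite -supp_or; [|exact: upclosed_interval_exp..].
  by split; apply: supp_weak => al /interval_exp_cons.
- exact: IHcs.
- by apply: IHcs => i /andP[/gh -> ->].
apply: pdle_ext (IHcs (fun i => g i && c i) h _); last by move=> i /andP[/gh].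
move=> u; split=> [H|[H1 H2] al ne].
  by split; apply: supp_weak H => al /(interval_exp_and _ _ _ gh) [].
by apply/interval_exp_and => //; split; [apply: H1 | apply: H2].
Qed.

Lemma free_res_meet C (cs : seq {ffun 'I_n -> bool}) :
  (forall f, C f <-> exists2 S, {subset S <= cs} & f =1 meet_fun S) ->
  free_res_le (Istar K C) (size cs).
Proof.
move=> CE; apply/free_res_leE.
apply: pdle_ext (pdle_interval cs (g := xpredT) (h := xpredT) _) => // u.
rewrite Istar_supp; split; apply: supp_weak => al.
  case=> S Scs [SP _]; exists [ffun i => meet_fun S i].
    by apply/CE; exists S => // i; rewrite ffunE.
  by apply: dominates_ext SP => i; rewrite ffunE andbT.
case=> f /CE [S Scs fE] fal; exists S => //.
by split; apply: dominates_ext fal => i; rewrite fE andbT.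
Qed.

End FunctionIdeals.

(** * Koszul complexes on variables: exactness and product cycles *)

Section Koszul.
Variables (R : comNzRingType) (m : nat).
Local Open Scope ring_scope.
Local Notation S := (mpoly R m).
Local Notation x_ := (mvar R m).

(* The Koszul complex on the variables [js], as an iterated mapping cone. *)
Fixpoint ksize (js : seq nat) (j : nat) : nat :=
  match js with
  | [::] => if j is 0 then 1%N else 0%N
  | y :: js' => if j is j'.+1 then (ksize js' j'.+1 + ksize js' j')%N else ksize js' 0
  end.

(** Acting on columns, [kdiff js j] maps degree j + 1 to degree j. With a new variable y, a chain a
    + b e_y goes to d a + y b - (d b) e_y. *)
Fixpoint kdiff (js : seq nat) : forall j, 'M[S]_(ksize js j, ksize js j.+1) :=
  match js return forall j, 'M[S]_(ksize js j, ksize js j.+1) with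
  | [::] => fun j => 0
  | y :: js' => fun j =>
      match j return 'M[S]_(ksize (y :: js') j, ksize (y :: js') j.+1) with
      | 0 => row_mx (kdiff js' 0) (x_ y)%:M
      | j'.+1 => block_mx (kdiff js' j'.+1) (x_ y)%:M 0 (- kdiff js' j')
      end
  end.

Lemma kdiff_sq js j : kdiff js j *m kdiff js j.+1 = 0.
Proof.
elim: js j => [|y js IHjs] [|j] /=; rewrite ?mul0mx //.
  rewrite [LHS](mul_row_block (kdiff js 0)) IHjs mulmx0 addr0.
  by rewrite mul_mx_scalar mulmxN mul_scalar_mx subrr row_mx0.
rewrite [LHS](mulmx_block (kdiff js j.+1)) IHjs !mulmx0 !mul0mx !addr0 !add0r.
rewrite !mulmxN mulNmx opprK IHjs mul_mx_scalar mul_scalar_mx subrr.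
exact: block_mx0.
Qed.

Definition some_pos (js : seq nat) (al : nat -> nat) : Prop := has (fun j => 0 < al j)%N js.

Lemma upclosed_some_pos js : (forall j, j \in js -> (j < m)%N) -> upclosed m (some_pos js).
Proof.
move=> jm al be le_ab /hasP[j jjs al0]; apply/hasP; exists j => //.
by apply: leq_trans (le_ab _ (jm _ jjs)).
Qed.

Lemma some_pos_sub js js' (a : S) : {subset js <= js'} -> supp (some_pos js) a ->
  supp (some_pos js') a.
Proof. by move=> sub; apply: supp_weak => al /hasP[j /sub jjs al0]; apply/hasP; exists j. Qed.

Lemma supp_scalar P (a : S) k (i j : 'I_k) : supp P a -> supp P ((a%:M : 'M[S]_k) i j).
Proof. by move=> Pa; rewrite mxE; case: eqP => _; rewrite ?mulr1n ?mulr0n //; apply: supp0. Qed.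

Lemma kdiff_supp js j i k : (forall j, j \in js -> (j < m)%N) ->
  supp (some_pos js) (kdiff js j i k).
Proof.
elim: js j i k => [|y js IHjs] j i k jm; first by rewrite /= mxE; apply: supp0.
have jm' l : l \in js -> (l < m)%N by move=> ljs; apply: jm; rewrite inE ljs orbT.
have sub : {subset js <= y :: js} by move=> l ljs; rewrite inE ljs orbT.
have Hy k0 (i0 j0 : 'I_k0) : supp (some_pos (y :: js)) (((x_ y)%:M : 'M_k0) i0 j0).
  apply: supp_scalar => al /mcoef_mvar al0; apply/hasP; exists y; rewrite ?mem_head //.
  by apply: al0; apply: jm; rewrite mem_head.
have Hd j0 i0 k0 : supp (some_pos (y :: js)) (kdiff js j0 i0 k0).
  exact: some_pos_sub (IHjs _ _ _ jm').
case: j i k => [|j] /= i k.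
  by rewrite mxE; case: splitP => k0 _.
rewrite mxE; case: splitP => i0 _; rewrite mxE; case: splitP => k0 _ //.
  by rewrite mxE; apply: supp0.
by rewrite mxE; apply: suppN.
Qed.

Lemma mulmx_supp P Q T a b c (A : 'M[S]_(a, b)) (B : 'M[S]_(b, c)) :
  (forall be ga, P be -> Q ga -> T (fun j => be j + ga j)%N) -> upclosed m T ->
  (forall i j, supp P (A i j)) -> (forall i j, supp Q (B i j)) ->
  forall i j, supp T ((A *m B) i j).
Proof.
move=> PQT upT PA QB i j; rewrite mxE; apply: (ideal_sum _ (supp_ideal R upT)) => k.
exact: suppM PQT upT (PA _ _) (QB _ _).
Qed.

Lemma choose_mx a b (Q : 'I_a -> 'I_b -> S -> Prop) :
  (forall i j, exists x, Q i j x) -> exists A : 'M[S]_(a, b), forall i j, Q i j (A i j).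
Proof.
move=> H; have /fin_all_exists [f Qf] : forall i, exists g : 'I_b -> S, forall j, Q i j (g j).
  by move=> i; apply: fin_all_exists.
by exists (\matrix_(i, j) f i j) => i j; rewrite mxE.
Qed.

Lemma kdiff0_im js c (v : 'M[S]_(ksize js 0, c)) : uniq js ->
  (forall j, j \in js -> (j < m)%N) -> (forall i k, supp (some_pos js) (v i k)) ->
  exists W, v = kdiff js 0 *m W.
Proof.
move: v; elim: js => [|y js IHjs] v.
  move=> _ _ v0; exists 0; rewrite mulmx0; apply/matrixP => i k; rewrite mxE.
  by apply: mcoef_inj => al; apply: NNPP => /v0.
move=> /andP[yjs ujs] jm vS.
have jm' l : l \in js -> (l < m)%N by move=> ljs; apply: jm; rewrite inE ljs orbT.
have ym : (y < m)%N by apply: jm; rewrite mem_head.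
(* Each entry is a multiple of y plus an element of the ideal of the remaining variables; [E]
   collects the quotients by y. *)
have [E EP] : exists E : 'M[S]_(ksize js 0, c), forall i k,
    supp (some_pos js) (v i k - x_ y * E i k).
  apply: (choose_mx (Q := fun i k e => supp (some_pos js) (v i k - x_ y * e))) => i k.
  have /supp_or [] : supp (fun al => (forall j, j \in [:: y] -> (0 < al j)%N) \/
      some_pos js al) (v i k).
  - apply: supp_weak (vS i k) => al /orP[al0|]; last by right.
    by left=> j; rewrite inE => /eqP->.
  - by apply: upclosed_all => j; rewrite inE => /eqP->.
  - exact: upclosed_some_pos.
  move=> b [c0 [bS cS e]].
  have [|e' eE] := (@supp_allE R m [:: y] b isT _).1 bS; first by move=> j; rewrite inE => /eqP->.
  by exists e'; rewrite e eE big_seq1 mulrC addrAC subrr add0r.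
have [|W WE] := IHjs (v - x_ y *: E) ujs jm'.
  by move=> i k; rewrite !mxE; apply: EP.
exists (col_mx W E); rewrite [RHS](mul_row_col (kdiff js 0)) -WE mul_scalar_mx.
by rewrite subrK.
Qed.

(** If the e_y-component of a cycle is a boundary d W2, then Y1 + y W2 is a cycle of the smaller
    complex, hence some d W1, and (W1, -W2) bounds the given cycle. *)
Lemma kcone_exact y js j c (Y1 : 'M[S]_(ksize js j.+1, c)) (W2 : 'M[S]_(ksize js j.+1, c)) :
  (forall Y : 'M[S]_(ksize js j.+1, c), kdiff js j *m Y = 0 ->
    exists W, Y = kdiff js j.+1 *m W) ->
  kdiff js j *m Y1 + x_ y *: (kdiff js j *m W2) = 0 ->
  exists W, col_mx Y1 (kdiff js j *m W2) = kdiff (y :: js) j.+1 *m W.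
Proof.
move=> ex e; have [|W1 W1E] := ex (Y1 + x_ y *: W2); first by rewrite mulmxDr -scalemxAr.
exists (col_mx W1 (- W2)) => /=.
rewrite [RHS](mul_block_col (kdiff js j.+1)) -W1E mul_scalar_mx scalerN addrK.
by rewrite mul0mx add0r mulmxN mulNmx opprK.
Qed.

Lemma kdiff_exact js j c (Y : 'M[S]_(ksize js j.+1, c)) : uniq js ->
  (forall j, j \in js -> (j < m)%N) -> kdiff js j *m Y = 0 ->
  exists W, Y = kdiff js j.+1 *m W.
Proof.
move: j Y; elim: js => [|y js IHjs] j Y.
  move=> _ _ _; by exists 0; rewrite mulmx0 [Y]flatmx0.
move=> /andP[yjs ujs] jm.
have jm' l : l \in js -> (l < m)%N by move=> ljs; apply: jm; rewrite inE ljs orbT.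
have ym : (y < m)%N by apply: jm; rewrite mem_head.
have ex j0 Z := IHjs j0 Z ujs jm'.
have [Y1 [Y2 ->]] : exists (Y1 : 'M[S]_(ksize js j.+1, c)) (Y2 : 'M[S]_(ksize js j, c)),
    Y = col_mx Y1 Y2.
  by exists (@usubmx _ (ksize js j.+1) _ _ Y), (@dsubmx _ (ksize js j.+1) _ _ Y); rewrite vsubmxK.
move=> {Y}.
case: j Y1 Y2 => [|j] Y1 Y2.
  rewrite [X in X = _](mul_row_col (kdiff js 0)) mul_scalar_mx => e.
  (* The variable y is a nonzerodivisor modulo the ideal of the others: y Y2 = - d Y1 has entries in
     that ideal, and lowering the exponent of y keeps them there. So [Y2] is a boundary in degree
     0. *)
  have [|W2 W2E] := @kdiff0_im js c Y2 ujs jm'.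
    move=> i k al; rewrite -(mcoef_mvar_inc _ _ ym) => ne.
    have H : supp (some_pos js) ((kdiff js 0 *m Y1) i k).
      apply: (mulmx_supp (P := some_pos js) (Q := fun _ => True)) => //.
      - move=> be ga /hasP[l ljs l0] _; apply/hasP; exists l => //.
        by rewrite addn_gt0 l0.
      - exact: upclosed_some_pos.
      - by move=> i0 k0; apply: kdiff_supp.
    have /hasP[] : some_pos js (inc al y).
      apply: H; move/eqP: e; rewrite addr_eq0 => /eqP ->; rewrite !mxE mcoefN => e; apply: ne.
      by apply/eqP; rewrite -oppr_eq0 e.
    move=> l ljs; rewrite /inc /upd; case: eqP => [ly|_ l0].
      by rewrite -ly ljs in yjs.
    by apply/hasP; exists l.
  by rewrite W2E in e *; have := kcone_exact (ex 0%N) e.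
rewrite [X in X = _](mul_block_col (kdiff js j.+1)) mul0mx add0r mul_scalar_mx => e.
have [e1 e2] : kdiff js j.+1 *m Y1 + x_ y *: Y2 = 0 /\ - kdiff js j *m Y2 = 0.
  by apply: eq_col_mx; rewrite col_mx0.
have [|W2 W2E] := ex _ Y2; first by apply/eqP; rewrite -oppr_eq0 -mulNmx e2.
by rewrite W2E in e1 *; have := kcone_exact (ex j.+1) e1.
Qed.

Definition kcycle js j : 'cV[S]_(ksize js j) -> Prop :=
  if j is j'.+1 then fun X => kdiff js j' *m X = 0 else fun _ => True.

(** The inclusion of the subcomplex of chains without e_y. *)
Definition kinl y js j : 'cV[S]_(ksize js j) -> 'cV[S]_(ksize (y :: js) j) :=
  if j is j'.+1 then fun X => col_mx X 0 else id.

Lemma kinl0 y js j : @kinl y js j 0 = 0.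
Proof. by case: j => //= j; apply: col_mx0. Qed.

Lemma kinlD y js j X Y : @kinl y js j X + kinl y Y = kinl y (X + Y).
Proof. by case: j X Y => //= j X Y; rewrite [LHS]add_col_mx addr0. Qed.

Lemma kinlZ y js j a X : a *: @kinl y js j X = kinl y (a *: X).
Proof. by case: j X => //= j X; rewrite [LHS]scale_col_mx scaler0. Qed.

Lemma kinl_supp P y js j (X : 'cV[S]_(ksize js j)) : (forall i, supp P (X i 0)) ->
  forall i, supp P (kinl y X i 0).
Proof.
case: j X => //= j X PX i; rewrite mxE; case: splitP => k _ //.
by rewrite mxE; apply: supp0.
Qed.

Lemma kdiff_inl y js j X : kdiff (y :: js) j *m @kinl y js j.+1 X = kinl y (kdiff js j *m X).
Proof.
case: j X => [|j] X /=; first by rewrite [LHS](mul_row_col (kdiff js 0)) mulmx0 addr0.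
by rewrite [LHS](mul_block_col (kdiff js j.+1)) !mulmx0 mul0mx !addr0.
Qed.

Lemma kcycle_inl y js j X : @kcycle js j X -> kcycle (@kinl y js j X).
Proof. by case: j X => // j X XE; rewrite /kcycle kdiff_inl XE kinl0. Qed.

Lemma kcycleZ js j a X : @kcycle js j X -> kcycle (a *: X).
Proof. by case: j X => // j X /= XE; rewrite -scalemxAr XE scaler0. Qed.

Lemma kdiff_col y js j A B : kcycle B ->
  kdiff (y :: js) j *m col_mx A B = kinl y (kdiff js j *m A + x_ y *: B).
Proof.
case: j A B => [|j] A B /= BE.
  by rewrite [LHS](mul_row_col (kdiff js 0)) mul_scalar_mx.
by rewrite [LHS](mul_block_col (kdiff js j.+1)) mul_scalar_mx mul0mx mulNmx BE add0r oppr0.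
Qed.

(* The product over the pairs (a, b) in [us] of the cycles x_b e_a - x_a e_b. *)
Lemma koszul_product_cycle (us : seq (nat * nat)) (w : (nat -> nat) -> nat)
    (Q : (nat -> nat) -> Prop) (p : S) :
  (forall u, u \in us -> (u.1 < m)%N && (u.2 < m)%N) ->
  (forall u al, u \in us -> w (inc al u.2) = (w al).+1) ->
  upclosed m Q -> supp Q p -> ~ supp (fun al => 0 < w al)%N p ->
  exists X : 'cV[S]_(ksize (flatten [seq [:: u.2; u.1] | u <- us]) (size us)),
  [/\ kcycle X,
      forall i, supp (fun al => Q al /\ forall u, u \in us -> (0 < al u.1)%N || (0 < al u.2)%N) (X i 0) &
      ~ forall i, supp (fun al => size us < w al)%N (X i 0)].
Proof.
move=> usm wS upQ Qp wp; elim: us usm wS => [|[a b] us IHus] usm wS /=.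
  exists p%:M; split=> // [i|/(_ 0)]; last by rewrite mxE.
  by apply: supp_scalar; apply: supp_weak Qp.
have sub u : u \in us -> u \in (a, b) :: us by rewrite inE orbC => ->.
have [|| X [cX QX wX]] := IHus.
- by move=> u /sub /usm.
- by move=> u al /sub /wS.
have /andP[/= am bm] := usm _ (mem_head _ _).
set js := flatten _ in X cX QX wX *.
have supp_x c (x : S) : (c < m)%N -> (c == a) || (c == b) ->
    supp (fun al => Q al /\ forall u, u \in us -> (0 < al u.1)%N || (0 < al u.2)%N) x ->
    supp (fun al => Q al /\ forall u, u \in (a, b) :: us -> (0 < al u.1)%N || (0 < al u.2)%N) (x_ c * x).
  move=> cm cab; apply: (suppM (P := fun al => 0 < al c)%N).
  - move=> be ga bc [Qg gus]; split; first by apply: upQ Qg => j _; apply: leq_addl.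
    move=> u; rewrite inE !addn_gt0 => /orP[/eqP ->|/gus /orP[] -> /=]; rewrite ?orbT //=.
    by move: cab bc => /orP[] /eqP -> ->; rewrite ?orbT.
  - move=> al be le_ab [Qa aus]; split; first exact: upQ Qa.
    move=> u uus; have /andP[u1 u2] := usm u uus.
    by have /orP[h|h] := aus u uus; rewrite (leq_trans h (le_ab _ _)) ?orbT.
  - by move=> al; apply: mcoef_mvar.
(* Together [Z0] and [Z1] are X times x_b e_a - x_a e_b: [Z1] is the coefficient of e_b, and x_b X
   is the coefficient of e_a. *)
pose Z0 : 'cV[S]_(ksize (a :: js) (size us).+1) := col_mx 0 (x_ b *: X).
pose Z1 : 'cV[S]_(ksize (a :: js) (size us)) := kinl a (- x_ a *: X).
exists (col_mx Z0 Z1 : 'cV[S]_(ksize (b :: a :: js) (size us).+1)).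
have cZ1 : kcycle Z1 by apply/kcycle_inl/kcycleZ.
split.
- change (kdiff (b :: a :: js) (size us) *m col_mx Z0 Z1 = 0).
  rewrite (@kdiff_col b (a :: js) _ Z0 Z1 cZ1) (@kdiff_col a js _ 0 _ (kcycleZ (x_ b) cX)).
  rewrite mulmx0 add0r kinlZ kinlD !scalerA mulrN scaleNr [x_ b * _]mulrC subrr.
  by rewrite !kinl0.
- move=> i; rewrite [X in supp _ X]mxE; case: splitP => k _.
    rewrite mxE; case: splitP => l _; first by rewrite mxE; apply: supp0.
    by rewrite mxE; apply: supp_x; rewrite ?eqxx ?orbT.
  apply: kinl_supp => l; rewrite mxE mulNr; apply: suppN.
  by apply: supp_x; rewrite ?eqxx.
(* Multiplication by x_b raises every weight by exactly one, so a monomial of small weight in X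
   survives in the block x_b X. *)
move=> H; apply: wX => i al ne.
have := H (lshift _ (rshift _ i)) (inc al b).
rewrite [X in mcoef X _]col_mxEu [X in mcoef X _]col_mxEd mxE mcoef_mvar_inc //.
by move=> /(_ ne); rewrite (wS (a, b)) ?mem_head.
Qed.

End Koszul.

(** * Shattered sets bound the length of resolutions from below *)

Section LowerBound.
Variables (K : fieldType) (n : nat).

Definition weight (js : seq nat) (al : nat -> nat) : nat := \sum_(j <- js) al j.

Lemma weight_inc js al j : uniq js -> j \in js -> weight js (inc al j) = (weight js al).+1.
Proof.
move=> ujs jjs; rewrite /weight !(bigD1_seq j jjs ujs) /= /inc /upd eqxx addSn.
by congr (_ + _).+1; apply: eq_bigr => l /negbTE ->.
Qed.

Lemma upclosed_weight m js k : (forall j, j \in js -> j < m) ->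
  upclosed m (fun al => k <= weight js al).
Proof.
move=> jm al be le_ab /leq_trans; apply; rewrite /weight !big_seq.
by apply: leq_sum => j jjs; apply: le_ab; apply: jm.
Qed.

Lemma shattered_le_free_res (C : fclass n) (U : {set 'I_n}) q :
  shattered C U -> free_res_le (Istar K C) q -> #|U| <= q.
Proof.
move=> shU /free_res_leE pdq; rewrite leqNgt; apply/negP => ltqU.
pose us := [seq (vidx (i : 'I_n) true, vidx i false) | i <- enum U].
pose js := flatten [seq [:: u.2; u.1] | u <- us].
have szus : size us = #|U| by rewrite size_map -cardE.
have jsP (i : 'I_n) b : (vidx i b \in js) = (i \in U).
  apply/flatten_mapP/idP => [[_ /mapP[l lU ->]] /=|iU].
    rewrite !inE => /orP[] /eqP /vidx_inj [/val_inj -> _]; by rewrite mem_enum in lU.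
  exists (vidx i true, vidx i false); first by apply: map_f; rewrite mem_enum.
  by case: b; rewrite !inE eqxx ?orbT.
have jsE : js = flatten [seq [:: vidx (i : 'I_n) false; vidx i true] | i <- enum U].
  by rewrite /js /us -map_comp.
have ujs : uniq js.
  rewrite jsE; elim: (enum U) (enum_uniq U) => //= i s IHs /andP[is_ us'].
  have F b : vidx i b \notin flatten [seq [:: vidx (i : 'I_n) false; vidx i true] | i <- s].
    apply/negP => /flatten_mapP[l ls]; rewrite !inE.
    by move=> /orP[] /eqP /vidx_inj [/val_inj il _]; rewrite il ls in is_.
  rewrite inE negb_or !F IHs // !andbT; apply/eqP => /vidx_inj; by case.
have jm j : j \in js -> j < 2 * n.
  by rewrite jsE => /flatten_mapP[i _]; rewrite !inE => /orP[] /eqP ->; apply: vidx_lt.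
pose Q al := forall j, j < 2 * n -> j \notin js -> 0 < al j.
have upQ : upclosed (2 * n) Q.
  by move=> al be le_ab Qa j j2 njs; apply: leq_trans (Qa j j2 njs) (le_ab _ j2).
(* The exponent of the product of all variables outside U; it satisfies [Q] and has weight 0. *)
pose al0 j := nat_of_bool (j \notin js).
have [|||||X [cX QX wX]] := @koszul_product_cycle K (2 * n) us (weight js) Q (mono K (2 * n) al0).
- by move=> u /mapP[i _ ->]; rewrite !vidx_lt.
- move=> u al /mapP[i iU ->] /=; apply: weight_inc => //.
  by rewrite jsP; rewrite mem_enum in iU.
- exact: upQ.
- by apply: supp_mono => // j _ njs; rewrite /al0 njs.
- move=> /(_ al0); rewrite mcoef_mono_self => /(_ _)/wrap[]; first exact/eqP/oner_neq0.
  by rewrite lt0n /weight big_seq big1 // => j jjs; rewrite /al0 jjs.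
pose I u : Prop := emb1 (Istar K C) u.
(* With |U| = t + 1 > q, the cycle lies in degree t + 1, where Tor vanishes. *)
case: (size us) szus X cX QX wX => [|t] szus X cX QX wX.
  by rewrite -szus in ltqU.
have sI : submod I.
  have idI : ideal (Istar K C).
    have [z D M] : ideal (@supp K (2 * n) (fun al => exists2 f, C f & dominates al f)).
      apply: supp_ideal => al be le_ab [f Cf fal]; exists f => //; exact: upclosed_dominates fal.
    split; first exact/Istar_supp.
      by move=> a b /Istar_supp Ia /Istar_supp Ib; apply/Istar_supp/D.
    by move=> c a /Istar_supp Ia; apply/Istar_supp/M.
  have [I0 ID IM] := idI.
  rewrite /I /emb1; split=> [|u v|c u]; rewrite !mxE //; [exact: ID | exact: IM].
have [||||W IW XE] := pdle_acyclic (@kdiff_sq K (2 * n) js) _ sI pdq (t := t) (X := X).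
- by move=> j c Y; apply: kdiff_exact.
- by rewrite -ltnS szus.
- move=> i; rewrite /I /emb1 mxE; apply/Istar_supp.
  (* Shattering gives f in C equal to 1 at exactly those u in U whose variable x_(u,0) occurs; at
     the other u in U the variable x_(u,1) must occur. Thus the generator of f divides the
     monomial. *)
  apply: supp_weak (QX i) => al [Qal Ual].
  have [f [Cf fU]] := shU [ffun i => 0 < al (vidx (i : 'I_n) false)].
  exists f => // l; case lU: (l \in U); last by apply: Qal; rewrite ?vidx_lt // jsP lU.
  rewrite fU // ffunE; case E: (0 < al (vidx l false)) => //=.
  have /Ual /= : (vidx l true, vidx l false) \in us by apply: map_f; rewrite mem_enum.
  by rewrite E orbF.
- exact: cX.
(* An entry of the differential contributes degree at least one, and an entry of [W], lying in the
   ideal, at least one for each point of U: more than |U| in total. *)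
apply: wX => i; rewrite XE.
apply: (mulmx_supp (P := some_pos js) (Q := fun al => t < weight js al)).
- move=> be ga /hasP[j jjs bj] tw; rewrite /weight big_split /= -addn1 addnC.
  apply: leq_add => //; rewrite (bigD1_seq j) //=.
  exact: leq_trans bj (leq_addr _ _).
- exact: upclosed_weight.
- by move=> i0 k0; apply: kdiff_supp.
move=> i0 k0; rewrite [k0]ord1; have := IW i0; rewrite /I /emb1 mxE => /Istar_supp.
apply: supp_weak => al [f Cf fal]; rewrite szus cardE /weight jsE big_flatten big_map.
rewrite -sum1_size; apply: leq_sum => l _; rewrite big_cons big_seq1.
by have := fal l; case: (f l) => /= H; rewrite addn_gt0 H ?orbT.
Qed.

End LowerBound.

(** * Existence of extremal dimensions *)

Lemma ex_least (P : nat -> Prop) p : P p -> exists q, P q /\ forall r, P r -> q <= r.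
Proof.
elim/ltn_ind: p => p IHp Pp.
case: (classic (exists2 r, r < p & P r)) => [[r lt_rp Pr]|nP]; first exact: IHp Pr.
exists p; split=> // r Pr; rewrite leqNgt; apply/negP => lt_rp.
by apply: nP; exists r.
Qed.

Section VCDimension.
Variables (n : nat).

Lemma vcdim_exists (C : fclass n) f : C f -> exists v, is_vcdim C v.
Proof.
(* Minimising n - |U| yields a shattered set of maximal size; the empty set is shattered since C
   contains [f]. *)
move=> Cf; pose P k := exists U, shattered C U /\ #|U| = n - k.
have cardU (U : {set 'I_n}) : #|U| <= n by rewrite -[n in _ <= n]card_ord max_card.
have [|q [[U [shU UE]] qmin]] := @ex_least P n.
  exists set0; split; last by rewrite cards0 subnn.
  by move=> g; exists f; split=> // i; rewrite inE.
exists (n - q); split; first by exists U.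
move=> V shV; have /qmin qV : P (n - #|V|) by exists V; rewrite subKn.
by rewrite leq_subRL ?(leq_trans qV (leq_subr _ _)) // addnC -leq_subRL.
Qed.

Lemma shattered_sub (C C' : fclass n) U :
  (forall f, C f -> C' f) -> shattered C U -> shattered C' U.
Proof. by move=> CC' shU g; have [f [Cf fg]] := shU g; exists f; split=> //; apply: CC'. Qed.

End VCDimension.

(** * CNFs as conjunctions of members of a fixed list of clauses *)

Lemma nat_of_bits d (b : nat -> bool) :
  exists2 x, x < 2 ^ d & forall j, j < d -> odd (x %/ 2 ^ j) = b j.
Proof.
elim: d b => [|d IHd] b; first by exists 0.
have [x lt_x xb] := IHd (fun j => b j.+1).
exists (b 0 + x.*2).
  by rewrite expnS mul2n; case: (b 0); rewrite ?add0n ?ltn_double // add1n ltn_Sdouble.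
case=> [|j] lt_jd; first by rewrite expn0 divn1 oddD odd_double addbF oddb.
rewrite expnS divnMA divn2 -xb //; congr (odd (_ %/ _)).
by rewrite half_bit_double.
Qed.

Section CNF.
Variables (d k : nat).
Implicit Types (A s : {set 'I_d}) (i : 'I_(2 ^ d)).

Lemma lit_evalE (l : literal d) i : lit_eval l i = (Defs.coord l.1 i == l.2).
Proof. by rewrite /lit_eval; case: l.2; case: Defs.coord. Qed.

Lemma point_with_zeros : exists pt : {set 'I_d} -> 'I_(2 ^ d),
  forall A j, Defs.coord j (pt A) = (j \notin A).
Proof.
have /fin_all_exists [pt ptP] A : exists i, forall j, Defs.coord j i = (j \notin A).
  have [x lt_x xb] := nat_of_bits d (fun j => ~~ [exists l in A, val l == j]).
  exists (Ordinal lt_x) => j; rewrite /Defs.coord /= xb //; congr (~~ _).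
  apply/existsP/idP => [[l /andP[lA /eqP/val_inj <-]] //|jA].
  by exists j; rewrite jA eqxx.
by exists pt.
Qed.

(** Normal form of a clause without repeated variables: [s] marks the positive ones. Clauses are
    then counted through pairs [(A, s)]. *)
Definition set_clause A s : seq (literal d) := [seq (j, j \in s) | j <- enum A].

Lemma size_set_clause A s : size (set_clause A s) = #|A|.
Proof. by rewrite size_map cardE. Qed.

Lemma mem_set_clause A s l : (l \in set_clause A s) = (l.1 \in A) && (l.2 == (l.1 \in s)).
Proof.
apply/mapP/andP => [[j jA ->] /=|[lA /eqP e]]; first by rewrite mem_enum in jA.
by exists l.1; rewrite ?mem_enum // -e; case: l {lA e}.
Qed.

Lemma set_clause_evalF A s i : (forall j, j \in A -> Defs.coord j i = (j \notin s)) ->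
  clause_eval (set_clause A s) i = false.
Proof.
move=> H; apply/hasP => -[l]; rewrite mem_set_clause lit_evalE => /andP[lA /eqP ->].
by rewrite H //; case: (_ \in s).
Qed.

Definition clause_fun A s : {ffun 'I_(2 ^ d) -> bool} := [ffun i => clause_eval (set_clause A s) i].

Definition clause_vars (c : seq (literal d)) : {set 'I_d} := [set j in map fst c].

Lemma card_clause_vars c : #|clause_vars c| <= size c.
Proof. by rewrite cardsE -(size_map fst c); apply: card_size. Qed.

Lemma mem_clause_vars c l : l \in c -> l.1 \in clause_vars c.
Proof. by move=> lc; rewrite inE map_f. Qed.

(* A conjunction f of allowed clauses is the conjunction of all members of cs implied by f. *)
Lemma cnf_meet (D : pred (seq (literal d))) (cs : seq {ffun 'I_(2 ^ d) -> bool})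
    (f : {ffun 'I_(2 ^ d) -> bool}) :
  (forall c, c \in cs -> exists2 c', D c' & c =1 clause_eval c') ->
  (forall c i, D c -> clause_eval c i = false ->
     exists2 c', c' \in cs & c' i = false /\ forall i', clause_eval c i' -> c' i') ->
  (exists F, all D F /\ forall i, f i = cnf_eval F i) <->
  (exists2 S, {subset S <= cs} & f =1 meet_fun S).
Proof.
move=> csD Dcs; split=> [[F [/allP DF fF]]|[S Scs fS]]; last first.
  suff [F [DF FS]] : exists F, all D F /\ meet_fun S =1 cnf_eval F.
    by exists F; split=> // i; rewrite fS FS.
  elim: S Scs {f fS} => [|c S IHS] Scs; first by exists [::].
  have [|F [DF FS]] := IHS; first by move=> x xS; apply: Scs; rewrite inE xS orbT.
  have [c' Dc' cE] := csD c (Scs _ (mem_head _ _)).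
  exists (c' :: F); split=> [|i]; first by rewrite /= Dc'.
  by rewrite /meet_fun /= cE; congr (_ && _); apply: FS.
exists [seq c : {ffun _ -> _} <- cs | [forall i, f i ==> c i]].
  by move=> c; rewrite mem_filter => /andP[].
move=> i; case fi: (f i).
  apply/esym/allP => c; rewrite mem_filter => /andP[/forallP /(_ i)].
  by rewrite fi.
have /allPn [c cF ci] : ~~ cnf_eval F i by rewrite -fF fi.
have [c' c'cs [c'i cc']] := Dcs c i (DF c cF) (negbTE ci).
apply/esym/negbTE/allPn; exists c'; last by rewrite c'i.
rewrite mem_filter c'cs andbT; apply/forallP => i'; apply/implyP.
by rewrite fF => /allP /(_ c cF); apply: cc'.
Qed.

Definition mono_clauses := [seq clause_fun A setT | A <- enum [set A : {set 'I_d} | #|A| <= k]].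

Lemma kCNF_mono_meet f : kCNF_mono d k f <->
  exists2 S, {subset S <= mono_clauses} & f =1 meet_fun S.
Proof.
rewrite -(@cnf_meet (fun c => (size c <= k) && all (fun l => l.2) c)).
- split=> [[F [kF [mF fF]]]|[F [DF fF]]]; exists F.
    by split=> //; rewrite all_predI; apply/andP.
  by move: DF; rewrite all_predI => /andP[].
- move=> c /mapP[A]; rewrite mem_enum inE => Ak ->; exists (set_clause A setT).
    rewrite size_set_clause Ak; apply/allP => l.
    by rewrite mem_set_clause inE => /andP[_ /eqP].
  by move=> i; rewrite ffunE.
move=> c i /andP[ck /allP cm] ci.
(* A monotone clause depends only on its set of variables. *)
have E i' : clause_fun (clause_vars c) setT i' = clause_eval c i'.
  rewrite ffunE; apply: eq_has_r => l; rewrite mem_set_clause inE.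
  apply/andP/idP => [[/mapP[l' l'c e] /eqP e2]|lc].
    by rewrite [l]surjective_pairing e e2 inE -(cm _ l'c) -surjective_pairing.
  by rewrite map_f // inE cm.
exists (clause_fun (clause_vars c) setT); last by split=> [|i']; rewrite E.
by apply: map_f; rewrite mem_enum inE (leq_trans (card_clause_vars c)).
Qed.

Lemma size_mono_clauses : size mono_clauses = \sum_(0 <= i < k.+1) 'C(d, i).
Proof.
rewrite size_map -cardE; elim: k => [|k' IHk].
  rewrite big_nat1 -[in RHS](card_ord d) -card_draws; apply: eq_card => A.
  by rewrite !inE leqn0.
rewrite big_nat_recr //= -IHk -[in 'C(d, _)](card_ord d) -card_draws -cardsUI.
rewrite [X in _ + #|pred_of_set X|](_ : _ = set0) ?cards0 ?addn0.
  by apply: eq_card => A; rewrite !inE leq_eqVlt orbC ltnS.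
by apply/setP => A; rewrite !inE; case: eqP => [->|_]; rewrite ?ltnn ?andbF.
Qed.

Definition full_clauses := [seq clause_fun p.1 p.2 |
  p <- enum [set p : {set 'I_d} * {set 'I_d} | (#|p.1| == k) && (p.2 \subset p.1)]].

Lemma superset_of_card A : #|A| <= k <= d -> exists2 B : {set 'I_d}, A \subset B & #|B| = k.
Proof.
case/andP=> Ak kd.
have /card_geqP [s [us ss sA]] : k - #|A| <= #|~: A|.
  by rewrite leq_subLR cardsC card_ord.
exists (A :|: [set x in s]); first exact: subsetUl.
rewrite cardsU (_ : A :&: _ = set0) ?cards0 ?subn0.
  by rewrite cardsE (card_uniqP us) ss subnKC.
apply/setP => x; rewrite !inE; apply/negP => /andP[xA /sA].
by rewrite inE xA.
Qed.

(** For a clause c false at i, the variables of c are enlarged to a k-set [A], and the clause on [A]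
    with all literals false at i is taken. It contains every literal of c, so c implies it. *)
Lemma kCNF_meet f : k <= d -> kCNF d k f <->
  exists2 S, {subset S <= full_clauses} & f =1 meet_fun S.
Proof.
move=> kd; rewrite -(@cnf_meet (fun c => size c <= k)) //.
  move=> c /mapP[[A s]]; rewrite mem_enum inE => /andP[/= /eqP Ak _] ->.
  exists (set_clause A s); first by rewrite size_set_clause Ak.
  by move=> i; rewrite ffunE.
move=> c i ck ci.
have [|A cA Ak] := @superset_of_card (clause_vars c).
  by rewrite kd (leq_trans (card_clause_vars c)).
pose s := A :&: [set j | ~~ Defs.coord j i].
exists (clause_fun A s).
  by apply: (map_f (fun p => clause_fun p.1 p.2)) (A, s) _;
    rewrite mem_enum inE /= Ak eqxx subsetIl.
split=> [|i']; first by rewrite ffunE set_clause_evalF // => j jA; rewrite !inE jA negbK.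
rewrite ffunE => /hasP[l lc li']; apply/hasP; exists l => //.
have lA := subsetP cA _ (mem_clause_vars lc).
rewrite mem_set_clause !inE lA /=.
have : lit_eval l i = false by apply/negP => li; move/negP: ci; apply; apply/hasP; exists l.
by rewrite lit_evalE; case: (Defs.coord _ _); case: l.2.
Qed.

Lemma size_full_clauses : size full_clauses = 2 ^ k * 'C(d, k).
Proof.
rewrite size_map -cardE.
transitivity (\sum_(A : {set 'I_d} | #|A| == k) \sum_(B : {set 'I_d} | B \subset A) 1).
  by rewrite pair_big_dep -sum1_card /=; apply: eq_bigl => p; rewrite inE.
rewrite (eq_bigr (fun _ => 2 ^ k)) => [|A /eqP Ak].
  by rewrite sum_nat_cond_const -[in RHS](card_ord d) -card_draws mulnC cardsE.
by rewrite -Ak -card_powerset -sum1_card; apply: eq_bigl => B; rewrite inE.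
Qed.

(** The monotone clause on a k-set A is false at the point with zero set A and true at the points of
    all other k-sets. The conjunction of the clauses of those A where [g] is false therefore
    realises [g]. *)
Lemma kCNF_mono_shatters : exists2 U, shattered (kCNF_mono d k) U & #|U| = 'C(d, k).
Proof.
have [pt ptP] := point_with_zeros.
have pt_inj : injective pt.
  by move=> A B e; apply/setP => j; apply: negb_inj; rewrite -!ptP e.
exists (pt @: [set A : {set 'I_d} | #|A| == k]); last first.
  by rewrite card_imset // card_draws card_ord.
move=> g; pose F := [seq set_clause A setT |
  A <- enum [set A : {set 'I_d} | (#|A| == k) && ~~ g (pt A)]].
exists [ffun i => cnf_eval F i]; split.
  exists F; split.
    by apply/allP => _ /mapP[A + ->]; rewrite mem_enum inE size_set_clause => /andP[/eqP ->].
  split=> [|i]; last by rewrite ffunE.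
  apply/allP => _ /mapP[A _ ->]; apply/allP => l.
  by rewrite mem_set_clause inE => /andP[_ /eqP].
move=> _ /imsetP[A + ->]; rewrite inE ffunE => /eqP Ak.
case gA: (g (pt A)); last first.
  apply/negP => /allP /(_ (set_clause A setT)) H; suff: clause_eval (set_clause A setT) (pt A).
    by rewrite set_clause_evalF // => j jA; rewrite ptP jA inE.
  by apply: H; apply: map_f; rewrite mem_enum inE Ak eqxx gA.
apply/allP => _ /mapP[B + ->]; rewrite mem_enum inE => /andP[/eqP Bk gB].
have /subsetPn [j jB jA] : ~~ (B \subset A).
  apply: contra gB => BA; suff -> : B = A by [].
  by apply/eqP; rewrite eqEcard BA Ak Bk /=.
apply/hasP; exists (j, true); first by rewrite mem_set_clause jB inE.
by rewrite lit_evalE ptP jA.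
Qed.

Lemma kCNF_mono_sub f : kCNF_mono d k f -> kCNF d k f.
Proof. by case=> F [kF [_ fF]]; exists F. Qed.

Lemma kCNF_mono_true : kCNF_mono d k [ffun => true].
Proof. by exists [::]; split=> //; split=> // i; rewrite ffunE. Qed.

End CNF.

(** * Comparison of the two dimensions *)

Lemma dims_exist (K : fieldType) n (C : fclass n) f U (cs : seq {ffun 'I_n -> bool}) :
  C f -> shattered C U ->
  (forall f, C f <-> exists2 S, {subset S <= cs} & f =1 meet_fun S) ->
  exists v h, [/\ is_vcdim C v, dim_h K C h, #|U| <= v, v <= h & h <= size cs].
Proof.
move=> Cf shU CE; have [v vC] := vcdim_exists Cf.
have [h [hC hmin]] := ex_least (free_res_meet K CE).
exists v, h; split=> //; first by case: vC => _ /(_ U shU).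
  by case: vC => -[V [shV <-]] _; apply: shattered_le_free_res hC.
exact/hmin/free_res_meet.
Qed.

(** * The numerical bound *)

Lemma sum_bin_nat d k : k <= d ->
  (\sum_(0 <= i < k.+1) 'C(d, i)) * (k ^ k * d ^ (d - k)) <= (d + k) ^ d.
Proof.
move=> kd; rewrite expnDn big_distrl /= -(big_mkord xpredT (fun i => 'C(d, i) * (d ^ (d - i) * k ^ i))).
rewrite [leqRHS](big_cat_nat (n := k.+1)) //=; apply: leq_trans (leq_addr _ _).
rewrite !big_nat; apply: leq_sum => i; rewrite ltnS => /andP[_ ik]; rewrite leq_mul2l; apply/orP; right.
(* After cancelling common factors, k^(k-i) <= d^(k-i) remains. *)
have -> : d - i = (d - k) + (k - i) by rewrite addnBA // subnK.
have -> : k ^ k = k ^ i * k ^ (k - i) by rewrite -expnD subnKC.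
rewrite expnD -mulnA [leqRHS]mulnC leq_mul2l; apply/orP; right.
rewrite mulnC leq_mul2l; apply/orP; right.
by case: (k - i) => // e; rewrite leq_exp2r.
Qed.

Section RealBound.
Local Open Scope R_scope.

Lemma INR_expn a b : INR (expn a b) = INR a ^ b.
Proof. by elim: b => //= b IHb; rewrite expnS mult_INR IHb. Qed.

Lemma exp_mul_nat x j : exp x ^ j = exp (INR j * x).
Proof.
elim: j => [|j IHj]; first by rewrite /= Rmult_0_l exp_0.
by rewrite -tech_pow_Rmult IHj -exp_plus S_INR; congr exp; ring.
Qed.

Lemma sum_bin_le_exp d k : (1 <= k)%N -> (k <= d)%N ->
  INR (\sum_(0 <= i < k.+1) 'C(d, i)) <= (exp 1 * (INR d / INR k)) ^ k.
Proof.
move=> k1 kd.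
have kpos : 0 < INR k by apply: lt_0_INR; apply/ltP.
have dpos : 0 < INR d by apply: lt_0_INR; apply/ltP; apply: leq_trans kd.
set s := (\sum_(0 <= i < k.+1) 'C(d, i))%N.
have H : INR s * (INR k ^ k * INR d ^ (d - k)) <= (INR d + INR k) ^ d.
  by rewrite -!INR_expn -plus_INR -!mult_INR -INR_expn; apply: le_INR; apply/leP; apply: sum_bin_nat.
(* The factor d^d is taken out and 1 + k/d <= exp(k/d) is raised to the power d. *)
have e : (INR d + INR k) ^ d <= INR d ^ d * exp (INR k).
  have -> : INR d + INR k = INR d * (1 + INR k / INR d) by field; lra.
  rewrite Rpow_mult_distr; apply: Rmult_le_compat_l; first by apply: pow_le; lra.
  have -> : exp (INR k) = exp (INR k / INR d) ^ d by rewrite exp_mul_nat; congr exp; field; lra.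
  apply: pow_incr; split; last exact: exp_ineq1_le.
  by have := Rdiv_lt_0_compat _ _ kpos dpos; lra.
have dd : INR d ^ d = INR d ^ k * INR d ^ (d - k).
  by rewrite -pow_add -[(k + _)%coq_nat]/(k + (d - k))%N subnKC.
have kk := pow_lt _ k kpos; have dk := pow_lt _ (d - k)%N dpos.
(* Multiplied by k^k d^(d-k), the right-hand side becomes exactly d^d e^k. *)
apply: (Rmult_le_reg_r (INR k ^ k * INR d ^ (d - k))); first exact: Rmult_lt_0_compat.
apply: Rle_trans (Rle_trans _ _ _ H e) _; rewrite dd; apply: Req_le.
rewrite !Rpow_mult_distr exp_mul_nat Rmult_1_r pow_inv.
by field; lra.
Qed.

End RealBound.

Theorem mainTheorem13 (K : fieldType) (d k : nat) :
  (1 <= k)%N -> (k <= d)%N ->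
  (exists vp hp : nat,
     is_vcdim (kCNF_mono d k) vp /\ dim_h K (kCNF_mono d k) hp /\
     ('C(d, k) <= vp)%N /\ (vp <= hp)%N /\
     (hp <= \sum_(0 <= i < k.+1) 'C(d, i))%N /\
     Rle (INR (\sum_(0 <= i < k.+1) 'C(d, i)))
         (Rpow_def.pow (Rmult (exp 1) (Rdiv (INR d) (INR k))) k)) /\
  (exists v h : nat,
     is_vcdim (kCNF d k) v /\ dim_h K (kCNF d k) h /\
     ('C(d, k) <= v)%N /\ (v <= h)%N /\ (h <= 2 ^ k * 'C(d, k))%N).
Proof.
move=> k1 kd; have [U shU Uk] := kCNF_mono_shatters d k; split.
  have [v [h [vC hC Uv vh hN]]] :=
    dims_exist K (kCNF_mono_true d k) shU (fun f => kCNF_mono_meet k f).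
  exists v, h; do !split=> //; [by rewrite -Uk | by rewrite -size_mono_clauses |].
  exact: sum_bin_le_exp.
(* The set shattered by the monotone class is shattered by the larger class as well. *)
have [v [h [vC hC Uv vh hN]]] := dims_exist K (kCNF_mono_sub (kCNF_mono_true d k))
  (shattered_sub (@kCNF_mono_sub d k) shU) (fun f => kCNF_meet f kd).
by exists v, h; do !split=> //; rewrite -?Uk // Uk -size_full_clauses.
Qed.
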